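(* Let $n\in\mathbb{N}=\{1,2,3,\dots\}$, let $\nu,\alpha,\beta\in\mathbb{R}$ with $n-1<\nu<n$, $\alpha>-1$, $\beta>0$, and let $x\in(-1,1)$. Then the C-Jacobi function $P_\nu^{(\alpha,\beta)}$ satisfies $$P_\nu^{(\alpha,\beta)}(x)=\frac{(-1)^\nu\,\Gamma(\nu+\beta+1)}{\Gamma(\nu+1)\Gamma(\beta+1)}\left(\frac{1-x}{2}\right)^{\nu}{}_2F_1\left(-\nu,-\nu-\alpha;\beta+1;\frac{x+1}{x-1}\right)$$ and $$P_\nu^{(\alpha,\beta)}(x)=\frac{(-1)^\nu\,\Gamma(\nu+\beta+1)}{\Gamma(\nu+1)\Gamma(\beta+1)}\;{}_2F_1\left(-\nu,\nu+\alpha+\beta+1;\beta+1;\frac{x+1}{2}\right).$$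
   Context: For $n\in\mathbb{N}$, $n-1<\nu<n$ and $x>a$, the Caputo fractional derivative of order $\nu$ with lower terminal $a$ is $${}_aD^\nu_*f(x)=\frac{1}{\Gamma(n-\nu)}\int_a^x\frac{f^{(n)}(\tau)}{(x-\tau)^{\nu+1-n}}\,d\tau .$$ For $n-1<\nu<n$ and $x\in(-1,1)$ the C-Jacobi function $P_\nu^{(\alpha,\beta)}$ is defined by $$(1-x)^\alpha(1+x)^\beta P_\nu^{(\alpha,\beta)}(x)=\frac{(-1)^\nu}{2^\nu\,\Gamma(\nu+1)}\;{}_{-1}D^\nu_*\left[(1-x)^{\nu+\alpha}(1+x)^{\nu+\beta}\right].$$ Here $(-1)^s:=e^{i\pi s}$ for real $s$. ${}_2F_1(a,b;c;z)$ is the Gauss hypergeometric function, $\sum_{k\ge0}\frac{(a)_k(b)_k}{(c)_k}\frac{z^k}{k!}$ for $|z|<1$ with $(a)_0=1$, $(a)_k=a(a+1)\cdots(a+k-1)$, and its analytic continuation to $\mathbb{C}\setminus[1,\infty)$ otherwise. *)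

(* Defs.v *)
From HB Require Import structures.
From mathcomp Require Export all_boot all_order all_algebra.
From mathcomp Require Export complex.
From mathcomp Require Export all_classical all_reals all_analysis.
Export Order.TTheory GRing.Theory Num.Theory.
Export numFieldNormedType.Exports.

Set Implicit Arguments.
Unset Strict Implicit.
Unset Printing Implicit Defensive.

Local Open Scope classical_set_scope.
Local Open Scope ring_scope.
Local Open Scope complex_scope.

(* Euler's integral: it is the Gamma function only for 0 < s, which covers
   every argument occurring below. *)
Definition Gamma (R : realType) (s : R) : R :=
  \int[lebesgue_measure]_(t in `]0, +oo[) (t `^ (s - 1) * expR (- t)).

(* Meant for n - 1 < nu < n and a < x. The integral is a Lebesgue integral, so
   the endpoint singularities need no separate limit. *)
Definition caputo (R : realType) (n : nat) (nu a : R) (f : R -> R) (x : R) : R :=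
  (Gamma (n%:R - nu))^-1 *
  \int[lebesgue_measure]_(t in `]a, x[) (derive1n n f t / (x - t) `^ (nu + 1 - n%:R)).

(* (-1)^s, i.e. exp (i pi s) *)
Definition m1pow (R : realType) (s : R) : R[i] :=
  cos (pi * s) +i* sin (pi * s).

(* The defining equation, divided by the weight (1-x)^al (1+x)^be, which does
   not vanish on ]-1, 1[. *)
Definition C_jacobi (R : realType) (n : nat) (nu al be x : R) : R[i] :=
  m1pow nu / (2 `^ nu * Gamma (nu + 1))%:C *
  (caputo n nu (- 1)
     (fun t => (1 - t) `^ (nu + al) * (1 + t) `^ (nu + be)) x)%:C /
  ((1 - x) `^ al * (1 + x) `^ be)%:C.

(* The alias R[i]^o carries the topology given by the complex modulus. *)
Definition csums (R : realType) (u : nat -> R[i]) (w l : R[i]) : Prop :=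
  [series (u k * w ^+ k : R[i]^o)]_k @ \oo --> (l : R[i]^o).

Definition canalytic_at (R : realType) (F : R[i] -> R[i]) (z0 : R[i]) : Prop :=
  exists (u : nat -> R[i]) (r : R), 0 < r /\
    forall z, `|z - z0| < r%:C -> csums u (z - z0) (F z).

Definition pochhammer (R : realType) (a : R[i]) (k : nat) : R[i] :=
  \prod_(i < k) (a + i%:R).

Definition hyp2F1_coef (R : realType) (a b c : R[i]) (k : nat) : R[i] :=
  pochhammer a k * pochhammer b k / (pochhammer c k * k`!%:R).

Definition slit_plane (R : realType) : set R[i] :=
  [set z | ~ exists2 t : R, 1 <= t & z = t%:C].

Definition is_hyp2F1 (R : realType) (a b c : R[i]) (F : R[i] -> R[i]) : Prop :=
  (forall z, `|z| < 1 -> csums (hyp2F1_coef a b c) z (F z)) /\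
  (forall z, slit_plane z -> canalytic_at F z).

(* By the identity theorem is_hyp2F1 determines F on the slit plane; the values
   on the cut [1, +oo[ are unspecified. *)
Definition hyp2F1 (R : realType) (a b c : R[i]) : R[i] -> R[i] :=
  xget (fun=> 0) [set F | is_hyp2F1 a b c F].

(* Main.v *)
Require Import Defs.
From mathcomp Require Import ring lra measurable_realfun.

Set Implicit Arguments.
Unset Strict Implicit.
Unset Printing Implicit Defensive.

Local Open Scope classical_set_scope.
Local Open Scope ring_scope.
Local Open Scope complex_scope.

(** Put z = (1+x)/2, c = be+1, A = -nu-al and B = nu+be+1, and let u be the sum
    of the hypergeometric series with parameters A, B; c.

    The function whose Caputo derivative is taken is, in the variable s = 1+t,
    s^(nu+be) times the binomial series 2^(nu+al) (1-s/2)^(nu+al), which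
    converges on the whole range of integration because s < 2.  Differentiated
    term by term, it keeps the shape of a power of s times a power series, and
    each term becomes a beta integral against (x-t)^(n-nu-1).  By the formula
    B(p,q) = Gamma(p) Gamma(q) / Gamma(p+q) the Gamma factors telescope, and the
    Caputo derivative is 2^(nu+al) (1+x)^be Gamma(B)/Gamma(c) u(z)
    ([caputo_weight_eval]).  Both formulas of the theorem are therefore
    transformation formulas for u: Euler's, u(z) = (1-z)^al F(c-A, c-B; c; z),
    and Pfaff's, (1+t)^(-A) u(t/(1+t)) = F(c-B, A; c; -t) for t >= 0.

    Both transformations are proved by comparing solutions of the hypergeometric
    equation.  Zero is a singular point of it with exponents 0 and 1-c, so
    that a solution which is differentiable there is determined by its value;
    an energy estimate proves this ([singular_ode_unique]).  For Euler's formula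
    both sides are explicit functions on [0, 1[ ([euler_transformation]).  For
    Pfaff's, the argument -t leaves the disc of convergence, and what is known of
    the function is only that it is analytic off the cut and is the sum of the
    series in the unit disc.  Its real and imaginary parts along the negative
    axis are real analytic, so the equation, which holds on the disc, holds on the
    whole axis by the identity theorem ([ranalytic_identity]), and uniqueness for
    the equation identifies the values ([hyp2F1_negative_axis]).

    It remains to see that the analytic continuation exists.  When 0 < a < c and
    0 < b, choose an integer m > b.  The numbers (a)_k/(c)_k and (b)_k/(m)_k
    are the moments of two beta distributions, hence F(a,b;c;z) is the mean of
    (1 - z X Y)^(-m) for independent X and Y with these laws.  This kernel is a
    rational function of z, with no branch to choose, whose pole 1/(XY) lies on
    the cut; expanding it around a point off the cut gives the power
    series of the continuation there ([stieltjes_csums], [has_hyp2F1_base]).  The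
    contiguous relation F(a,b;c) = F(a+1,b;c) - (b/c) z F(a+1,b+1;c+1) then lowers
    a and b to the values needed here ([is_hyp2F1_exists]). *)

(** * Derivatives of real functions *)

Section Calculus.
Variable R : realType.
Implicit Types (f g : R -> R) (x df dg k : R).

Lemma is_derive_add f g x df dg : is_derive x 1 f df -> is_derive x 1 g dg ->
  is_derive x 1 (fun t => f t + g t) (df + dg).
Proof. by move=> Hf Hg; exact: is_deriveD. Qed.

Lemma is_derive_sub f g x df dg : is_derive x 1 f df -> is_derive x 1 g dg ->
  is_derive x 1 (fun t => f t - g t) (df - dg).
Proof. by move=> Hf Hg; exact: is_deriveB. Qed.

Lemma is_derive_mul f g x df dg : is_derive x 1 f df -> is_derive x 1 g dg ->
  is_derive x 1 (fun t => f t * g t) (df * g x + f x * dg).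
Proof.
move=> Hf Hg; apply: (is_derive_eq (is_deriveM Hf Hg)).
by rewrite /GRing.scale/= addrC mulrC [f x * _]mulrC; congr (_ + _); rewrite mulrC.
Qed.

Lemma is_derive_scale f x df k : is_derive x 1 f df ->
  is_derive x 1 (fun t => k * f t) (k * df).
Proof. by move=> Hf; exact: (is_deriveZ k Hf). Qed.

Lemma is_derive_inv f x df : is_derive x 1 f df -> f x != 0 ->
  is_derive x 1 (fun t => (f t)^-1) (- df / f x ^+ 2).
Proof.
move=> [Df <-] fx0; split; first exact: derivableV.
by rewrite deriveV// /GRing.scale/= -exprVn exprVn mulNr mulNr mulrC.
Qed.

Lemma is_derive_comp f g x df dg : is_derive (g x) 1 f df -> is_derive x 1 g dg ->
  is_derive x 1 (fun t => f (g t)) (df * dg).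
Proof. by move=> Hf Hg; exact: is_derive1_comp. Qed.

Lemma is_derive_pow f x df p : is_derive x 1 f df -> 0 < f x ->
  is_derive x 1 (fun t => f t `^ p) (p * f x `^ (p - 1) * df).
Proof. by move=> Hf f0; exact: (@is_derive_comp (fun t => t `^ p) f x _ _ (is_derive1_powR p f0) Hf). Qed.

Lemma is_derive_continuous f x df : is_derive x 1 f df -> {for x, continuous f}.
Proof.
by move=> [D _]; apply: differentiable_continuous; exact/derivable1_diffP.
Qed.
End Calculus.

(** * Euler's integrals of the first and second kind *)

Section EulerIntegrals.
Variable R : realType.
Implicit Types x p q y s t k c : R.
Local Notation mu := (@lebesgue_measure R).

Lemma powRD_gt0 x p q : 0 < x -> x `^ (p + q) = x `^ p * x `^ q.
Proof. by move=> x0; rewrite powRD// (gt_eqF x0) implybT. Qed.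

(** The truncated power s_+^(p-1).  With it Euler's integrals range over the whole
    line, where affine substitutions and Tonelli's theorem need no care about
    domains. *)
Definition pospow p s : R := if 0 < s then s `^ (p - 1) else 0.

Lemma pospow_ge0 p s : 0 <= pospow p s.
Proof. by rewrite /pospow; case: ifP => // _; exact: powR_ge0. Qed.

Lemma measurable_pospow p : measurable_fun [set: R] (pospow p).
Proof.
apply: measurable_fun_ifT => //.
exact: measurable_fun_ltr.
Qed.

Lemma pospowM p k s : 0 < k -> pospow p (k * s) = k `^ (p - 1) * pospow p s.
Proof.
move=> k0; rewrite /pospow pmulr_rgt0//; case: ifP => [s0|_]; last by rewrite mulr0.
by rewrite powRM// ltW.
Qed.

(** An affine map pushes Lebesgue measure forward to a multiple of itself.  Argued
    on measures, the substitution allows integrands that are singular at an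
    endpoint. *)
Lemma ge0_integral_affine (f : R -> \bar R) k c : 0 < k ->
  measurable_fun [set: R] f -> (forall x, 0 <= f x)%E ->
  (\int[mu]_x f x = k%:E * \int[mu]_x f (k * x + c)%R)%E.
Proof.
move=> k0 mf f0.
pose phi : R -> measurableTypeR R := fun x => k * x + c.
have mphi : measurable_fun [set: R] phi.
  by apply: measurable_funD => //; exact: measurable_funM.
have kV : 0 <= k^-1 by rewrite invr_ge0 ltW.
pose k1 : {nonneg R} := NngNum (ltW k0).
have H A : measurable A -> mu A = mscale k1 (pushforward mu phi) A.
  move=> mA.
  apply: (@lebesgue_measure_unique _ (mscale k1 (pushforward mu phi))) => //.
  move=> _ [[a b]] _ <-.
  rewrite /mscale /pushforward /=.
  transitivity (k%:E * mu (phi @^-1` `]a, b]))%E; last by [].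
  have -> : phi @^-1` `]a, b]%classic = `](a - c) / k, (b - c) / k]%classic.
    by apply/seteqP; split => x /=;
      rewrite !in_itv/= /phi ltr_pdivrMr// ler_pdivlMr// ltrBlDr lerBrDr [k * x]mulrC.
  rewrite !lebesgue_measure_itv/= !lte_fin ltr_pM2r ?invr_gt0// ltrD2r.
  case: ifP => _; last by rewrite mule0.
  by rewrite -!EFinB -EFinM; congr EFin; field; rewrite gt_eqF.
rewrite (eq_measure_integral (mscale k1 (pushforward mu phi))); last by move=> A mA _; exact: (H mphi).
rewrite ge0_integral_mscale//=.
by rewrite ge0_integral_pushforward.
Qed.

Definition egamma p : \bar R := (\int[mu]_s (pospow p s * expR (- s))%:E)%E.
Definition ebeta p q : \bar R := (\int[mu]_s (pospow p s * pospow q (1 - s))%:E)%E.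

Lemma measurable_pospow_onem p y : measurable_fun [set: R] (fun s => pospow p (y - s)).
Proof.
apply: (measurableT_comp (measurable_pospow p)).
exact: measurable_funB.
Qed.

(** By homogeneity, the substitution s = y s' makes the convolution of two
    truncated powers a multiple of a third one. *)
Lemma pospow_convolution p q y : 0 < y ->
  (\int[mu]_s (pospow p s * pospow q (y - s))%:E = (pospow (p + q) y)%:E * ebeta p q)%E.
Proof.
move=> y0.
have M x : measurable_fun [set: R] (fun s => pospow p s * pospow q (x - s)).
  apply: measurable_funM; [exact: measurable_pospow|exact: measurable_pospow_onem].
rewrite (@ge0_integral_affine _ y 0 y0); last 2 first.
- by apply/measurable_EFinP; exact: M.
- by move=> s; rewrite lee_fin mulr_ge0// pospow_ge0.
transitivity (y%:E * \int[mu]_s ((y `^ (p - 1) * y `^ (q - 1))%:E *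
    (pospow p s * pospow q (1 - s))%:E))%E.
  congr (_ * _)%E; apply: eq_integral => s _.
  rewrite -EFinM addr0 pospowM// -{2}[y]mulr1 -mulrBr pospowM//.
  by congr EFin; ring.
rewrite ge0_integralZl//; last 3 first.
- by apply/measurable_EFinP; exact: M.
- by move=> s _; rewrite lee_fin mulr_ge0// pospow_ge0.
- by rewrite lee_fin mulr_ge0// powR_ge0.
rewrite muleA -EFinM; congr (_%:E * _)%E.
rewrite /pospow y0 -powRD_gt0//.
rewrite -{1}[y]powRr1 ?ltW// -powRD_gt0//.
by congr (_ `^ _); ring.
Qed.

Lemma egamma_ge0 p : (0 <= egamma p)%E.
Proof. by apply: integral_ge0 => s _; rewrite lee_fin mulr_ge0// ?pospow_ge0// expR_ge0. Qed.

Lemma ebeta_ge0 p q : (0 <= ebeta p q)%E.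
Proof. by apply: integral_ge0 => s _; rewrite lee_fin mulr_ge0// ?pospow_ge0// expR_ge0. Qed.

Lemma measurable_pospow_exp p : measurable_fun [set: R] (fun s => pospow p s * expR (- s)).
Proof.
apply: measurable_funM; first exact: measurable_pospow.
by apply: measurableT_comp => //; exact: oppr_measurable.
Qed.

(** In the double integral of Gamma(p) Gamma(q), take the sum y of the two variables as
    a new variable; by Tonelli, what multiplies exp(-y) is the convolution
    of two truncated powers. *)
Lemma egammaM p q : (egamma p * egamma q = egamma (p + q) * ebeta p q)%E.
Proof.
have gm r := measurable_pospow_exp r.
have g0 r s : 0 <= pospow r s * expR (- s) by rewrite mulr_ge0 ?pospow_ge0 ?expR_ge0.
pose h := fun z : R * R => (pospow p z.1 * pospow q (z.2 - z.1) * expR (- z.2))%:E.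
have mh : measurable_fun setT h.
  apply/measurable_EFinP; apply: measurable_funM.
    apply: measurable_funM.
      by apply: measurableT_comp => //; exact: measurable_pospow.
    apply: (measurableT_comp (measurable_pospow q)).
    exact: measurable_funB.
  by apply: measurableT_comp => //; exact: measurableT_comp.
have h0 z : (0 <= h z)%E by rewrite lee_fin !mulr_ge0// ?pospow_ge0// expR_ge0.
transitivity (\int[mu]_s \int[mu]_y h (s, y))%E.
  rewrite /egamma -ge0_integralZr//; last 3 first.
  - by apply/measurable_EFinP; exact: gm.
  - by move=> s _; rewrite lee_fin.
  - exact: egamma_ge0.
  apply: eq_integral => s _.
  rewrite (@ge0_integral_affine (fun t => (pospow q t * expR (- t))%:E) 1 (- s))//; last 2 first.
  - by apply/measurable_EFinP; exact: gm.
  - by move=> t; rewrite lee_fin.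
  rewrite mul1e -ge0_integralZl//; last 3 first.
  - apply/measurable_EFinP; apply: (measurableT_comp (gm q)).
    by apply: measurable_funD => //; exact: measurable_funM.
  - by move=> t _; rewrite lee_fin.
  - by rewrite lee_fin.
  apply: eq_integral => t _; rewrite -EFinM /h/= mul1r; congr EFin.
  have -> : expR (- t) = expR (- s) * expR (- (t - s)) by rewrite -expRD; congr expR; ring.
  ring.
rewrite (@fubini_tonelli _ _ _ _ _ mu mu h)//.
rewrite /egamma -ge0_integralZr//; last 3 first.
- by apply/measurable_EFinP; exact: gm.
- by move=> s _; rewrite lee_fin.
- exact: ebeta_ge0.
apply: eq_integral => y _.
rewrite /h/=.
transitivity (\int[mu]_x ((pospow p x * pospow q (y - x))%:E * (expR (- y))%:E))%E => //.
rewrite ge0_integralZr//; last 2 first.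
- apply/measurable_EFinP; apply: measurable_funM; [exact: measurable_pospow|exact: measurable_pospow_onem].
- by move=> t _; rewrite lee_fin mulr_ge0// pospow_ge0.
have [y0|y0] := ltP 0 y.
  by rewrite pospow_convolution// EFinM muleAC.
rewrite (eq_integral (cst 0%E)).
  by rewrite integral0 mul0e /pospow ltNge y0/= mul0r mul0e.
move=> t _; rewrite /pospow/=; case: ifP => [t0|]; last by rewrite mul0r.
by rewrite ifF ?mulr0//; apply/negbTE; lra.
Qed.

Lemma is_derive_powR_div p x : p != 0 -> 0 < x ->
  is_derive x 1 (fun t => t `^ p / p) (x `^ (p - 1)).
Proof.
move=> p0 x0.
have := is_derive_scale p^-1 (is_derive1_powR p x0).
by rewrite mulKf// (_ : (fun t => p^-1 * t `^ p) = (fun t => t `^ p / p))//;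
   apply/funext => t; rewrite mulrC.
Qed.

Lemma integral_powR_away0 p e : 0 < p -> 0 < e -> e < 1 ->
  (\int[mu]_(s in `[(e : R), 1%R]) (s `^ (p - 1))%:E)%E = ((1 - e `^ p) / p)%:E.
Proof.
move=> p0 e0 e1.
have pN0 : p != 0 by rewrite gt_eqF.
have D x : 0 < x -> is_derive x 1 (fun t => t `^ p / p) (x `^ (p - 1)).
  by move=> x0; exact: is_derive_powR_div.
have C x : 0 < x -> {for x, continuous (fun t => t `^ p / p)}.
  by move=> /D; exact: is_derive_continuous.
rewrite (@continuous_FTC2 _ _ (fun t => t `^ p / p))//.
- by rewrite powR1 mulrBl EFinB.
- apply: derivable_within_continuous => x; rewrite in_itv/= => /andP[ex _].
  have x0 : 0 < x by exact: lt_le_trans ex.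
  by apply: (@ex_derive _ _ _ _ _ _ _ (is_derive1_powR (p - 1) x0)).
- split.
  + move=> x; rewrite in_itv/= => /andP[ex _].
    by apply: (@ex_derive _ _ _ _ _ _ _ (D x _)); exact: lt_trans ex.
  + by apply: cvg_at_right_filter; exact: C.
  + by apply: cvg_at_left_filter; exact: C.
- move=> x; rewrite in_itv/= => /andP[ex _]; rewrite derive1E.
  by apply: (@derive_val _ _ _ _ _ _ _ (D x _)); exact: lt_trans ex.
Qed.

(** For p < 1 the integrand is singular at 0, so the integral is obtained as the
    limit of the integrals over [1/(n+2), 1]. *)
Lemma ebeta1 p : 0 < p -> ebeta p 1 = (p^-1)%:E.
Proof.
move=> p0.
have -> : ebeta p 1 = (\int[mu]_(s in `](0 : R)%R, 1%R[) (s `^ (p - 1))%:E)%E.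
  rewrite integral_mkcond; apply: eq_integral => s _.
  rewrite patchE /pospow subrr powRr0 subr_gt0 mem_setE/= in_itv/=.
  by case: (0 < s); case: (s < 1); rewrite ?mulr1 ?mulr0 ?mul0r.
rewrite integral_itv_bndo_bndc/=; last by apply/measurable_EFinP; apply: measurable_funTS.
pose F n : set R := `[n.+2%:R^-1, 1]%classic.
have -> : `]0, 1]%classic = \bigcup_n F n.
  apply/seteqP; split => x /=; rewrite in_itv/=.
    move=> /andP[x0 x1].
    have [k] := ltr_add_invr x0; rewrite add0r => kx.
    exists k => //; rewrite /F/= in_itv/= x1 andbT.
    by rewrite (le_trans _ (ltW kx))// lef_pV2 ?posrE// ler_nat.
  move=> [k _]; rewrite /F/= in_itv/= => /andP[kx ->]; rewrite andbT.
  by rewrite (lt_le_trans _ kx).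
have H1 : (\int[mu]_(s in F i) (s `^ (p - 1))%:E)%E @[i --> \oo] -->
    (\int[mu]_(s in \bigcup_i F i) (s `^ (p - 1))%:E)%E.
  apply: ge0_nondecreasing_set_cvg_integral => //.
  - move=> m n mn; rewrite subsetEset => x; rewrite /F/= !in_itv/= => /andP[+ ->].
    rewrite andbT; apply: le_trans.
    by rewrite lef_pV2 ?posrE// ler_nat !ltnS.
  - by move=> i; exact: measurable_itv.
  - by move=> i; apply/measurable_EFinP; apply: measurable_funTS.
  - by move=> i x _; rewrite lee_fin powR_ge0.
rewrite -(cvg_lim _ H1)//.
apply/cvg_lim => //.
under eq_cvg => i.
  rewrite integral_powR_away0 ?invr_gt0//; last by rewrite invf_lt1 ?ltr1n.
  over.
apply: cvg_EFin; first by apply: nearW.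
suff H : (1 - (i.+2%:R^-1 : R) `^ p) / p @[i --> \oo] --> (1 - 0) / p.
  by move: H; rewrite subr0 mul1r.
apply: cvgM; last exact: cvg_cst.
apply: cvgB; first exact: cvg_cst.
apply: ((cvg_at_rightP (fun a => a `^ p) 0 0).1 (powR_cvg0 p0) (fun n => n.+2%:R^-1)).
split=> [k|]; first by rewrite invr_gt0.
by rewrite (@cvg_shiftS _ (@harmonic R)); exact: cvg_harmonic.
Qed.

End EulerIntegrals.

Section GammaBeta.
Variable R : realType.
Implicit Types x p q y s t k c : R.
Local Notation mu := (@lebesgue_measure R).

Lemma GammaE p : Gamma p = fine (egamma p).
Proof.
rewrite /Gamma /Rintegral integral_mkcond; congr fine; apply: eq_integral => s _.
by rewrite patchE /pospow mem_setE/= in_itv/= andbT; case: ifP => //; rewrite mul0r.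
Qed.

Lemma egamma1 : egamma (1 : R) = 1%E.
Proof.
rewrite -(@integral_exponential_pdf R 1 ltr01).
transitivity (\int[mu]_(s in `](0:R)%R, +oo[) (expR (- s))%:E)%E.
  rewrite [RHS]integral_mkcond; apply: eq_integral => s _.
  rewrite patchE /pospow mem_setE/= in_itv/= andbT subrr powRr0.
  by case: ifP => //; rewrite ?mul0r ?mul1r.
rewrite integral_itv_obnd_cbnd; last first.
  apply/measurable_EFinP; apply: measurable_funTS.
  by apply: measurableT_comp => //; exact: oppr_measurable.
rewrite integral_mkcond; apply: eq_integral => s _.
rewrite /exponential_pdf !patchE; case: ifP => // _.
by rewrite mul1r mulN1r.
Qed.

(** This is the case q = 1 of [egammaM], and it holds before anything is known
    about finiteness. *)
Lemma egammaS p : 0 < p -> egamma (p + 1) = (p%:E * egamma p)%E.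
Proof.
move=> p0; have := egammaM p 1; rewrite egamma1 mule1 ebeta1// => ->.
by rewrite muleCA -EFinM divff ?gt_eqF// mule1.
Qed.

Lemma egamma_nat n : egamma n.+1%:R = (n`!%:R)%:E :> \bar R.
Proof.
elim: n => [|n IH]; first exact: egamma1.
by rewrite -natr1 egammaS// IH -EFinM factS natrM.
Qed.

(** For p >= 1 the integrand lies below those of Gamma(1) and of a factorial
    added together; for p < 1 the functional equation reduces to p + 1. *)
Lemma egamma_fin p : 0 < p -> egamma p \is a fin_num.
Proof.
have H q : 1 <= q -> egamma q \is a fin_num.
  move=> q1; rewrite ge0_fin_numE ?egamma_ge0//.
  set n := (Num.truncn q).
  have qn : q <= n.+1%:R.
    by rewrite ltW// /n truncnS_gt// (le_trans _ q1).
  apply: (@le_lt_trans _ _ (egamma (1 : R) + egamma n.+1%:R)%E); last first.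
    by rewrite egamma1 egamma_nat -EFinD ltry.
  rewrite /egamma -ge0_integralD//; first last.
  - by apply/measurable_EFinP; exact: measurable_pospow_exp.
  - by move=> s _; rewrite lee_fin mulr_ge0 ?pospow_ge0 ?expR_ge0.
  - by apply/measurable_EFinP; exact: measurable_pospow_exp.
  - by move=> s _; rewrite lee_fin mulr_ge0 ?pospow_ge0 ?expR_ge0.
  apply: ge0_le_integral => //.
  - by move=> s _; rewrite lee_fin mulr_ge0 ?pospow_ge0 ?expR_ge0.
  - by apply/measurable_EFinP; exact: measurable_pospow_exp.
  - by apply: emeasurable_funD; apply/measurable_EFinP; exact: measurable_pospow_exp.
  - move=> s _; rewrite -EFinD lee_fin -mulrDl ler_wpM2r ?expR_ge0//.
    rewrite /pospow; case: ifP => [s0|]; last by rewrite addr0.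
    rewrite subrr powRr0; have [s1|s1] := leP s 1.
      apply: (@le_trans _ _ 1); last by rewrite lerDl powR_ge0.
      by rewrite -[leRHS](powRr0 s) ger_powR ?s0// subr_ge0.
    rewrite ler_wpDl//; apply: ler_powR; first exact: ltW.
    by rewrite lerB.
move=> p0; have := H (p + 1); rewrite lerDr ltW// => /(_ isT).
rewrite egammaS// => h.
have := egamma_ge0 p; move: h; case: (egamma p) => //=.
by rewrite gt0_muley ?lte_fin.
Qed.

Lemma egamma_neq0 p : egamma p != 0%E.
Proof.
rewrite gt_eqF//.
pose c := Num.min 1 (2 `^ (p - 1)) * expR (- 2) : R.
have c0 : 0 < c by rewrite mulr_gt0 ?expR_gt0// lt_min ltr01 powR_gt0.
apply: (@lt_le_trans _ _ (\int[mu]_(s in `](1:R)%R, 2%R]) c%:E)%E).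
  rewrite integral_cst//= lebesgue_measure_itv/= lte_fin ltr1n.
  by rewrite -EFinB -EFinM lte_fin mulr_gt0// subr_gt0 ltr1n.
rewrite integral_mkcond; apply: ge0_le_integral => //.
- by move=> s _; rewrite patchE; case: ifP => // _; rewrite lee_fin ltW.
- by apply/(measurable_restrictT _ _).1 => //; exact: measurable_cst.
- by apply/measurable_EFinP; exact: measurable_pospow_exp.
- move=> s _; rewrite patchE; case: ifPn => [|_]; last first.
    by rewrite lee_fin mulr_ge0 ?pospow_ge0 ?expR_ge0.
  rewrite mem_setE/= in_itv/= => /andP[s1 s2].
  have s0 : 0 < s by rewrite (lt_trans _ s1).
  rewrite lee_fin ler_pM ?expR_ge0 ?ler_expR ?lerN2//.
  rewrite /pospow s0 ge_min; have [p1|p1] := leP 1 p.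
    by apply/orP; left; rewrite -[leLHS](powRr0 s); apply: ler_powR; [exact: ltW|rewrite subr_ge0].
  apply/orP; right.
  have -> : p - 1 = - (1 - p) by ring.
  rewrite !powRN lef_pV2 ?posrE ?powR_gt0//.
  by apply: ge0_ler_powR; rewrite ?nnegrE ?subr_ge0// ltW.
Qed.

Lemma Gamma_gt0 p : 0 < p -> 0 < Gamma p.
Proof.
move=> p0; rewrite GammaE fine_gt0// lt_neqAle eq_sym egamma_neq0 egamma_ge0/=.
by rewrite -ge0_fin_numE ?egamma_fin// egamma_ge0.
Qed.

Lemma GammaS p : 0 < p -> Gamma (p + 1) = p * Gamma p.
Proof. by move=> p0; rewrite !GammaE egammaS// fineM// egamma_fin. Qed.

Lemma ebetaE p q : 0 < p -> 0 < q ->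
  ebeta p q = (Gamma p * Gamma q / Gamma (p + q))%:E.
Proof.
move=> p0 q0; have pq0 := addr_gt0 p0 q0.
have EG (r : R) : 0 < r -> egamma r = (Gamma r)%:E by move=> r0; rewrite GammaE fineK// egamma_fin.
have := egammaM p q; rewrite !EG// -EFinM => H.
by rewrite EFinM H muleAC -EFinM divff ?mul1e// gt_eqF// Gamma_gt0.
Qed.

Lemma eintegral_beta p q (a b : R) : 0 < p -> 0 < q -> a < b ->
  (\int[mu]_(s in `]a, b[) ((s - a) `^ (p - 1) * (b - s) `^ (q - 1))%:E)%E =
  ((b - a) `^ (p + q - 1) * (Gamma p * Gamma q / Gamma (p + q)))%:E.
Proof.
move=> p0 q0 ab; have y0 : 0 < b - a by rewrite subr_gt0.
have := @pospow_convolution _ p q _ y0; rewrite ebetaE// -EFinM.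
have -> : pospow (p + q) (b - a) = (b - a) `^ (p + q - 1) by rewrite /pospow y0.
move=> <-; rewrite [RHS](@ge0_integral_affine _ _ 1 (- a))//; last 2 first.
- apply/measurable_EFinP; apply: measurable_funM; first exact: measurable_pospow.
  exact: measurable_pospow_onem.
- by move=> s; rewrite lee_fin mulr_ge0// pospow_ge0.
rewrite mul1e integral_mkcond; apply: eq_integral => s _.
rewrite patchE mem_setE/= in_itv/= /pospow mul1r.
rewrite (_ : b - a - (s - a) = b - s) ?subr_gt0; last by ring.
by case: (a < s); case: (s < b); rewrite ?mulr0 ?mul0r.
Qed.

Lemma measurable_beta p q (a b : R) D :
  measurable_fun D (fun s => (s - a) `^ (p - 1) * (b - s) `^ (q - 1)).
Proof.
apply: measurable_funTS; apply: measurable_funM.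
- by apply: (measurableT_comp (measurable_powR _)); exact: measurable_funB.
- by apply: (measurableT_comp (measurable_powR _)); exact: measurable_funB.
Qed.

Lemma integrable_beta p q (a b : R) : 0 < p -> 0 < q -> a < b ->
  mu.-integrable `]a, b[ (fun s => ((s - a) `^ (p - 1) * (b - s) `^ (q - 1))%:E).
Proof.
move=> p0 q0 ab; apply/integrableP; split.
  by apply/measurable_EFinP; exact: measurable_beta.
under eq_integral => s _ do rewrite gee0_abs ?lee_fin ?mulr_ge0 ?powR_ge0//.
by rewrite eintegral_beta// ltry.
Qed.

Lemma Rintegral_beta p q (a b : R) : 0 < p -> 0 < q -> a < b ->
  \int[mu]_(s in `]a, b[) ((s - a) `^ (p - 1) * (b - s) `^ (q - 1)) =
  (b - a) `^ (p + q - 1) * (Gamma p * Gamma q / Gamma (p + q)).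
Proof. by move=> p0 q0 y0; rewrite /Rintegral eintegral_beta. Qed.

End GammaBeta.

(** * Real power series *)

Section PowerSeries.
Variable R : realType.
Implicit Types (c d : nat -> R) (r x y rho M : R).

(** The radius of convergence is at least r.  Cauchy's bounds are used rather than
    convergence, since they pass at once to derivatives and shifts and give uniform
    estimates of remainders. *)
Definition radius_ge r c :=
  forall rho, 0 < rho -> rho < r -> exists M, forall k, `|c k| * rho ^+ k <= M.

Definition psum c x : R := limn (pseries c x).

Lemma radius_ge_bound r c rho : radius_ge r c -> 0 < rho -> rho < r ->
  exists2 M, 0 < M & forall k, `|c k| * rho ^+ k <= M.
Proof.
move=> H r0 /(H _ r0)[M HM]; exists (`|M| + 1); first by rewrite ltr_wpDl.
by move=> k; rewrite (le_trans (HM k))// (le_trans (ler_norm _))// lerDl.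
Qed.

Lemma eventually_bounded_above (u : nat -> R) N M :
  (forall k, (N <= k)%N -> u k <= M) -> exists M', forall k, u k <= M'.
Proof.
move=> H; exists (\big[Num.max/M]_(i < N) u i) => k.
have [kN|Nk] := ltnP k N; last first.
  by rewrite (le_trans (H _ Nk))// bigmax_ge_id.
exact: (@le_bigmax _ _ _ M (fun i : 'I_N => u i) (Ordinal kN)).
Qed.

Lemma radius_ge_ratio c (q : nat -> R) : (forall k, `|c k.+1| <= q k * `|c k|) ->
  q @ \oo --> (1 : R) -> radius_ge 1 c.
Proof.
move=> cq q1 rho rho0 rho1.
have [N _ HN] : \forall k \near \oo, q k < rho^-1.
  by apply: (cvgr_lt _ q1); rewrite invf_gt1.
apply: (@eventually_bounded_above _ N (`|c N| * rho ^+ N)) => k.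
elim: k => [|k IH]; first by rewrite leqn0 => /eqP <-.
rewrite leq_eqVlt => /orP[/eqP <- //|]; rewrite ltnS => Nk.
apply: le_trans (IH Nk).
rewrite exprS mulrA; apply: ler_wpM2r; first by rewrite exprn_ge0 ?ltW.
rewrite -ler_pdivlMr//; apply: le_trans (cq k) _.
by rewrite mulrC; apply: ler_wpM2l => //; exact/ltW/HN.
Qed.

Lemma geometric_domination c x rho M : 0 < rho -> `|x| < rho ->
  (forall k, `|c k| * rho ^+ k <= M) ->
  forall k, `|c k * x ^+ k| <= geometric M (`|x| / rho) k.
Proof.
move=> rho0 xr HM k; rewrite /= expr_div_n mulrA ler_pdivlMr ?exprn_gt0//.
by rewrite normrM normrX mulrAC ler_wpM2r ?exprn_ge0.
Qed.

Lemma between_norm r x : `|x| < r -> exists2 rho, `|x| < rho & 0 < rho < r.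
Proof.
move=> xr; exists ((`|x| + r) / 2); have := normr_ge0 x; lra.
Qed.

Lemma radius_ge_cvg r c x : radius_ge r c -> `|x| < r -> cvgn (pseries c x).
Proof.
move=> H /between_norm[rho xrho /andP[rho0 rhor]].
have [M M0 HM] := radius_ge_bound H rho0 rhor.
apply: normed_cvg; apply: series_le_cvg.
- by move=> k; exact: normr_ge0.
- move=> k; exact: (le_trans _ (geometric_domination rho0 xrho HM k)).
- exact: geometric_domination.
apply: is_cvg_geometric_series.
by rewrite normrM normr_id normfV (gtr0_norm rho0) ltr_pdivrMr// mul1r.
Qed.

Lemma cvg_radius_ge r c : (forall x, 0 < x -> x < r -> cvgn (pseries c x)) -> radius_ge r c.
Proof.
move=> H rho rho0 rhor.
have [M [_ HM]] := cvg_series_bounded (H rho rho0 rhor).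
exists (`|M| + 1) => k.
have := HM (`|M| + 1); rewrite (le_lt_trans (ler_norm _)) ?ltrDl// => /(_ isT k I).
by rewrite /= normrM normrX (gtr0_norm rho0).
Qed.

Lemma psum_cvg r c x : radius_ge r c -> `|x| < r -> pseries c x @ \oo --> psum c x.
Proof. by move=> H xr; exact: (radius_ge_cvg H xr). Qed.

(** A factor k+1 is absorbed by a geometric one, by Bernoulli's inequality: the
    reason why differentiation does not shrink the radius of convergence. *)
Lemma bernoulli_bound (tau : R) : 0 < tau -> tau < 1 ->
  exists2 M, 0 < M & forall k, k.+1%:R * tau ^+ k <= M.
Proof.
move=> t0 t1; pose h := tau^-1 - 1.
have h0 : 0 < h by rewrite subr_gt0 invf_gt1.
have B k : 1 + k%:R * h <= (1 + h) ^+ k.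
  elim: k => [|k IH]; first by rewrite mul0r addr0 expr0.
  rewrite exprS; apply: le_trans (_ : (1 + h) * (1 + k%:R * h) <= _).
    rewrite -natr1; have : 0 <= k%:R * h * h by rewrite !mulr_ge0// ltW.
    lra.
  by rewrite ler_wpM2l// addr_ge0// ltW.
exists (1 + h^-1); first by rewrite addr_gt0 ?invr_gt0.
move=> k.
have Hk : tau ^+ k * (1 + h) ^+ k = 1.
  by rewrite -exprMn /h addrC subrK mulfV ?gt_eqF// expr1n.
have tk : 0 < tau ^+ k by rewrite exprn_gt0.
apply: le_trans (_ : (1 + h^-1) * (1 + k%:R * h) * tau ^+ k <= _).
  rewrite ler_wpM2r ?(ltW tk)//.
  have -> : (1 + h^-1) * (1 + k%:R * h) = 1 + k%:R * h + h^-1 + k%:R.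
    by field; rewrite gt_eqF.
  rewrite -natr1.
  have : 0 <= k%:R * h by rewrite mulr_ge0// ltW.
  have : 0 < h^-1 by rewrite invr_gt0.
  lra.
rewrite -mulrA; apply: ler_piMr; first by rewrite addr_ge0 ?invr_ge0 ?ltW.
by rewrite -[leRHS]Hk mulrC; apply: ler_wpM2l; [exact: ltW|exact: B].
Qed.

Lemma radius_ge_diffs r c : radius_ge r c -> radius_ge r (pseries_diffs c).
Proof.
move=> H rho rho0 rhor.
have [s rs sr] : exists2 s, rho < s & s < r by exists ((rho + r) / 2); lra.
have s0 : 0 < s by lra.
have [M M0 HM] := radius_ge_bound H s0 sr.
have [||B B0 HB] := @bernoulli_bound (rho / s).
- by rewrite divr_gt0.
- by rewrite ltr_pdivrMr// mul1r.
exists (B * (M / s)) => k.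
rewrite /pseries_diffs normrM ger0_norm//.
have -> : k.+1%:R * `|c k.+1| * rho ^+ k =
   (k.+1%:R * (rho / s) ^+ k) * (`|c k.+1| * s ^+ k.+1 / s).
  by rewrite expr_div_n exprS; field; rewrite ?expf_neq0 ?gt_eqF.
rewrite ler_pM//.
- by rewrite mulr_ge0// exprn_ge0// divr_ge0// ltW.
- by rewrite divr_ge0 ?mulr_ge0 ?exprn_ge0// ltW.
by rewrite ler_pM2r ?invr_gt0.
Qed.

Lemma is_derive_psum r c x : radius_ge r c -> `|x| < r ->
  is_derive x 1 (psum c) (psum (pseries_diffs c) x).
Proof.
move=> H /between_norm[rho xrho /andP[rho0 rhor]].
have rr : `|rho| < r by rewrite gtr0_norm.
have H1 := radius_ge_diffs H; have H2 := radius_ge_diffs H1.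
apply: (pseries_snd_diffs (K := rho)); try exact: radius_ge_cvg rr.
by rewrite (gtr0_norm rho0).
Qed.

Lemma psum_tail r c rho : radius_ge r c -> 0 < rho -> rho < r ->
  exists2 e : nat -> R, e @ \oo --> (0 : R) &
  forall K x, `|x| <= rho -> `|psum c x - pseries c x K| <= e K.
Proof.
move=> H rho0 rhor.
have [s rs sr] : exists2 s, rho < s & s < r by exists ((rho + r) / 2); lra.
have s0 : 0 < s by lra.
have [M M0 HM] := radius_ge_bound H s0 sr.
pose z := rho / s.
have z0 : 0 <= z by rewrite divr_ge0// ltW.
have z1 : z < 1 by rewrite ltr_pdivrMr// mul1r.
have D k x : `|x| <= rho -> `|c k * x ^+ k| <= M * z ^+ k.
  move=> xr; rewrite normrM normrX expr_div_n mulrA ler_pdivlMr ?exprn_gt0//.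
  rewrite mulrAC ler_pM ?mulr_ge0 ?exprn_ge0 ?(ltW s0)//.
  by apply: lerXn2r => //; rewrite nnegrE ltW.
exists (fun K => M * z ^+ K / (1 - z)).
  rewrite -(mul0r (1 - z)^-1); apply: cvgM; last exact: cvg_cst.
  by apply: cvg_geometric; rewrite ger0_norm.
move=> K x xr.
have xr' : `|x| < r by exact: le_lt_trans rhor.
have C := psum_cvg H xr'.
have C' : (pseries c x n - pseries c x K) @[n --> \oo] --> psum c x - pseries c x K.
  by apply: cvgB => //; exact: cvg_cst.
have C2 : `|pseries c x n - pseries c x K| @[n --> \oo] --> `|psum c x - pseries c x K|.
  exact: cvg_norm.
rewrite -(cvg_lim _ C2)//; apply: limr_le; first exact: (cvgP _ C2).
exists K => // n /= Kn.
rewrite /pseries sub_series_geq// (le_trans (ler_norm_sum _ _ _))//.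
apply: le_trans (_ : \sum_(K <= i < K + (n - K)) M * z ^+ i <= _).
  by rewrite subnKC//; apply: ler_sum => i _; exact: D.
rewrite -mulr_sumr geometric_partial_tail geometric_seriesE ?lt_eqF//=.
rewrite (_ : _ * _ = M * z ^+ K / (1 - z) * (1 - z ^+ (n - K))); last by rewrite !mulrA mulrAC.
apply: ler_piMr; last by rewrite lerBlDr lerDl exprn_ge0.
by rewrite divr_ge0 ?subr_ge0 ?mulr_ge0 ?exprn_ge0// ltW.
Qed.

(** The coefficients of the series multiplied by its variable. *)
Definition cshift c k : R := if k is k'.+1 then c k' else 0.

Lemma radius_ge_shift r c : radius_ge r c -> radius_ge r (cshift c).
Proof.
move=> H rho rho0 rhor; have [M M0 HM] := radius_ge_bound H rho0 rhor.
exists (M * rho) => -[|k]/=; first by rewrite normr0 mul0r mulr_ge0 ?ltW.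
by rewrite exprSr mulrA ler_pM2r.
Qed.

Lemma psum_shift r c x : radius_ge r c -> `|x| < r -> psum (cshift c) x = x * psum c x.
Proof.
move=> H xr; apply/cvg_lim => //; rewrite -cvg_shiftS.
have -> : (fun n => pseries (cshift c) x n.+1) = (fun n => x * pseries c x n).
  apply/funext => n; rewrite /pseries /series/= big_nat_recl//= mul0r add0r mulr_sumr.
  by apply: eq_bigr => i _; rewrite exprS mulrCA.
by apply: cvgM; [exact: cvg_cst|exact: psum_cvg xr].
Qed.

Lemma psum0 c : psum c 0 = c 0%N.
Proof.
apply/cvg_lim => //; rewrite -cvg_shiftS.
have -> : (fun n => pseries c 0 n.+1) = (fun=> c 0%N).
  apply/funext => n; rewrite /pseries /series/= big_nat_recl//= expr0 mulr1 big1 ?addr0// => i _.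
  by rewrite exprS mul0r mulr0.
exact: cvg_cst.
Qed.

(** A local form of constancy, for functions that are only known on an interval. *)
Lemma is_derive0_cst (f : R -> R) (a b : R) x y :
  (forall t, a < t < b -> is_derive t 1 f 0) -> a < x < b -> a < y < b -> f x = f y.
Proof.
move=> H; wlog xy : x y / x < y => [W|].
  move=> hx hy; have [/W->//|/W->//|->//] := ltgtP x y.
move=> /andP[ax xb] /andP[ay yb].
have Hd t : t \in `]x, y[ -> is_derive t 1 f ((fun=> 0) t).
  by rewrite in_itv/= => /andP[xt ty]; apply: H; lra.
have [|c _] := @MVT _ f (fun=> 0) x y xy Hd.
  apply: derivable_within_continuous => t; rewrite in_itv/= => /andP[xt ty].
  by apply: (@ex_derive _ _ _ _ _ _ _ (H t _)); lra.
by rewrite mul0r => /eqP; rewrite subr_eq0 => /eqP.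
Qed.

End PowerSeries.

(** * The hypergeometric series on the real unit interval *)

Section RealHypergeometric.
Variable R : realType.
Implicit Types (a b c p x : R) (k : nat).

Lemma cvg_addn_ratio a c : 0 < c -> (a + k%:R) / (c + k%:R) @[k --> \oo] --> (1 : R).
Proof.
move=> c0.
have ck k : 0 < c + k%:R by rewrite ltr_wpDr.
have H : (c + k%:R)^-1 @[k --> \oo] --> (0 : R).
  apply/gtr0_cvgV0; first by apply: nearW => k; exact: ck.
  have := @cvg_arithmetic R c 1 ltr01; apply: cvg_trans.
  by apply: near_eq_cvg; apply: nearW => k; rewrite /arithmetic.
have -> : (fun k => (a + k%:R) / (c + k%:R)) = (fun k => 1 + (a - c) * (c + k%:R)^-1).
  by apply/funext => k; field; rewrite gt_eqF.
rewrite -[X in _ --> X]addr0 -(mulr0 (a - c)).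
by apply: cvgD; [exact: cvg_cst|apply: cvgM => //; exact: cvg_cst].
Qed.

(** Real counterparts of [pochhammer] and [hyp2F1_coef]. *)
Definition rpoch a k : R := \prod_(i < k) (a + i%:R).
Definition rhyp a b c k : R := rpoch a k * rpoch b k / (rpoch c k * k`!%:R).

Lemma rpochS a k : rpoch a k.+1 = rpoch a k * (a + k%:R).
Proof. by rewrite /rpoch big_ord_recr. Qed.

Lemma rpoch_gt0 c k : 0 < c -> 0 < rpoch c k.
Proof. by move=> c0; apply: prodr_gt0 => i _; rewrite ltr_wpDr. Qed.

Lemma rhyp0 a b c : rhyp a b c 0 = 1.
Proof. by rewrite /rhyp /rpoch !big_ord0 !mul1r invr1. Qed.

Lemma rhypS a b c k : 0 < c ->
  rhyp a b c k.+1 = rhyp a b c k * ((a + k%:R) / (c + k%:R)) * ((b + k%:R) / (1 + k%:R)).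
Proof.
move=> c0; rewrite /rhyp !rpochS factS natrM -natr1.
by field; rewrite ?gt_eqF ?rpoch_gt0 ?ltr_wpDr ?ltr0n ?fact_gt0 ?ltr_wpDl.
Qed.

Lemma radius_rhyp a b c : 0 < c -> radius_ge 1 (rhyp a b c).
Proof.
move=> c0; apply: (@radius_ge_ratio _ _
    (fun k => `|((a + k%:R) / (c + k%:R)) * ((b + k%:R) / (1 + k%:R))|)).
  by move=> k; rewrite rhypS// -mulrA mulrC [leLHS]normrM mulrC.
have H := cvgM (cvg_addn_ratio a c0) (cvg_addn_ratio b ltr01).
by have := cvg_norm (H _); rewrite mulr1 normr1; apply.
Qed.

(** Coefficientwise, the equation is the recurrence
    (k+1)(c+k) h_(k+1) = (a+k)(b+k) h_k. *)
Lemma hypergeometric_ode a b c x : 0 < c -> `|x| < 1 ->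
  let h := rhyp a b c in
  x * (1 - x) * psum (pseries_diffs (pseries_diffs h)) x +
  (c - (a + b + 1) * x) * psum (pseries_diffs h) x - a * b * psum h x = 0.
Proof.
move=> c0 x1 h.
have H0 : radius_ge 1 h by exact: radius_rhyp.
have H1 := radius_ge_diffs H0; have H2 := radius_ge_diffs H1.
have S1 := radius_ge_shift H1; have S2 := radius_ge_shift H2; have S3 := radius_ge_shift S2.
pose D1 := pseries_diffs h; pose D2 := pseries_diffs D1.
have -> : x * (1 - x) * psum D2 x + (c - (a + b + 1) * x) * psum D1 x - a * b * psum h x =
   psum (cshift D2) x - psum (cshift (cshift D2)) x + c * psum D1 x
     - (a + b + 1) * psum (cshift D1) x - a * b * psum h x.
  by rewrite !(psum_shift _ x1)//; ring.
have Z : (fun n => pseries (cshift D2) x n - pseries (cshift (cshift D2)) x n + c * pseries D1 x n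
     - (a + b + 1) * pseries (cshift D1) x n - a * b * pseries h x n) @ \oo -->
  psum (cshift D2) x - psum (cshift (cshift D2)) x + c * psum D1 x
     - (a + b + 1) * psum (cshift D1) x - a * b * psum h x.
  have CC u (k : R) (Hu : radius_ge 1 u) : k * pseries u x n @[n --> \oo] --> k * psum u x.
    by apply: cvgM; [exact: cvg_cst|exact: psum_cvg x1].
  apply: cvgB; last exact: CC.
  apply: cvgB; last exact: CC.
  apply: cvgD; last exact: CC.
  by apply: cvgB; exact: psum_cvg x1.
apply: (@cvg_unique _ _ _ _ _ _ Z) => //.
rewrite (_ : (fun n => _) = cst 0); first exact: cvg_cst.
apply/funext => n; rewrite /pseries /series/= !mulr_sumr -!sumrB -big_split/= -!sumrB.
apply: big1 => k _.
suff E : cshift D2 k - cshift (cshift D2) k + c * D1 k - (a + b + 1) * cshift D1 k - a * b * h k = 0.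
  by rewrite -[RHS](mul0r (x ^+ k)) -E; ring.
rewrite /D2 /D1 /pseries_diffs /h rhypS//.
have ck : c + k%:R != 0 by rewrite gt_eqF// ltr_wpDr.
have k1 : 1 + k%:R != 0 :> R by rewrite gt_eqF// ltr_wpDr.
case: k ck k1 => [|[|k]] ck k1 /=.
- by field; rewrite gt_eqF.
- by rewrite (rhypS _ _ 1)//; field.
- rewrite (rhypS _ _ k.+2)//; field. by move: ck k1; rewrite -[k.+2]add2n natrD => -> ->.
Qed.

(** Both sides solve (1-t) u' = -p u: the quotient has derivative 0. *)
Lemma binomial_series p x : `|x| < 1 -> psum (rhyp (- p) 1 1) x = (1 - x) `^ p.
Proof.
move=> x1; set h := rhyp (- p) 1 1.
have H0 : radius_ge 1 h by exact: radius_rhyp.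
have H1 := radius_ge_diffs H0.
have E (t : R) : `|t| < 1 -> (1 - t) * psum (pseries_diffs h) t = - p * psum h t.
  move=> t1.
  suff : psum (pseries_diffs h) t - psum (cshift (pseries_diffs h)) t = - p * psum h t.
    by rewrite (psum_shift H1 t1) => <-; ring.
  have Z : pseries (pseries_diffs h) t n - pseries (cshift (pseries_diffs h)) t n @[n --> \oo] -->
     psum (pseries_diffs h) t - psum (cshift (pseries_diffs h)) t.
    by apply: cvgB; apply: psum_cvg t1 => //; exact: radius_ge_shift.
  apply: (@cvg_unique _ _ _ _ _ _ Z) => //.
  rewrite (_ : (fun n => _) = (fun n => - p * pseries h t n)).
    by apply: cvgM; [exact: cvg_cst|exact: psum_cvg t1].
  apply/funext => n; rewrite /pseries /series/= mulr_sumr -sumrB.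
  apply: eq_bigr => k _; rewrite -mulrBl mulrA; congr (_ * _).
  have k1 : 1 + k%:R != 0 :> R by rewrite gt_eqF// ltr_wpDr.
  rewrite /pseries_diffs /h rhypS//.
  case: k k1 => [|k] k1 /=; first by field.
  by field.
have D (t : R) : -1 < t < 1 -> is_derive t 1 (fun t => psum h t * (1 - t) `^ (- p)) 0.
  move=> t1; have t1' : `|t| < 1 by rewrite ltr_norml.
  have t0 : 0 < 1 - t by lra.
  have d1 : is_derive t 1 (fun t => 1 - t) (0 - 1).
    by apply: is_derive_sub.
  have := is_derive_mul (is_derive_psum H0 t1') (is_derive_pow (- p) d1 t0).
  congr (is_derive _ _ _ _).
  have -> : (1 - t) `^ (- p) = (1 - t) * (1 - t) `^ (- p - 1).
    by rewrite -{2}[1 - t]powRr1 ?ltW// -powRD_gt0//; congr (_ `^ _); ring.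
  transitivity (((1 - t) * psum (pseries_diffs h) t + p * psum h t) * (1 - t) `^ (- p - 1)).
    ring.
  by rewrite E//; ring.
have x1' : -1 < x < 1 by rewrite -ltr_norml.
have := is_derive0_cst D x1' (_ : -1 < 0 < 1).
rewrite psum0 {2}/h rhyp0 subr0 powR1 mulr1 => /(_ ltac:(lra)).
have x0 : 0 < 1 - x by lra.
by rewrite powRN => /(canRL (mulfVK _)) -> //; rewrite ?mul1r// gt_eqF ?powR_gt0.
Qed.

End RealHypergeometric.

(** * Term-by-term integration against a weight *)

Lemma cvg_dist_le (R : realType) (u : nat -> R) (l : R) (e : nat -> R) :
  (forall n, `|l - u n| <= e n) -> e @ \oo --> (0 : R) -> u @ \oo --> l.
Proof.
move=> H e0; apply/cvgrPdist_le => eps eps0.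
have [N _ HN] : \forall n \near \oo, e n <= eps by apply: (cvgr_le _ e0).
by exists N => // n /= Nn; exact: le_trans (H n) (HN n Nn).
Qed.

Section WeightedIntegrals.
Context d (T : measurableType d) (R : realType).
Variable mu : {measure set T -> \bar R}.
Implicit Types (D : set T) (w f : T -> R).

Lemma integrable_weight D w f B : measurable D -> mu.-integrable D (EFin \o w) ->
  measurable_fun D f -> (forall t, D t -> `|f t| <= B) ->
  mu.-integrable D (fun t => (w t * f t)%:E).
Proof.
move=> mD iw mf fB.
apply: (@integrableMl _ _ _ _ _ mD (EFin \o w) f iw mf).
by exists B; split; [exact: num_real|move=> M BM t Dt; exact: le_trans (fB t Dt) (ltW BM)].
Qed.

Lemma Rintegral_weight_le D w f B : measurable D -> mu.-integrable D (EFin \o w) ->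
  (forall t, D t -> 0 <= w t) ->
  measurable_fun D f -> (forall t, D t -> `|f t| <= B) ->
  `|\int[mu]_(t in D) (w t * f t)| <= B * \int[mu]_(t in D) w t.
Proof.
move=> mD iw w0 mf fB.
have iwf := integrable_weight mD iw mf fB.
apply: le_trans (le_normr_Rintegral _ _) _ => //.
rewrite -RintegralZl//; apply: le_Rintegral => //.
- exact: integrable_norm.
- exact: (@integrableZl _ _ _ _ _ mD B (EFin \o w) iw).
- by move=> t Dt; rewrite normrM (ger0_norm (w0 t Dt)) mulrC ler_wpM2r ?w0 ?fB.
Qed.

(** Against an integrable weight, uniform convergence suffices to exchange limit
    and integral. *)
Lemma Rintegral_weight_cvg D w f (F : nat -> T -> R) (e : nat -> R) B : measurable D ->
  mu.-integrable D (EFin \o w) -> (forall t, D t -> 0 <= w t) ->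
  measurable_fun D f -> (forall t, D t -> `|f t| <= B) ->
  (forall n, measurable_fun D (F n)) ->
  (forall n t, D t -> `|f t - F n t| <= e n) -> e @ \oo --> (0 : R) ->
  \int[mu]_(t in D) (w t * F n t) @[n --> \oo] --> \int[mu]_(t in D) (w t * f t).
Proof.
move=> mD iw w0 mf fB mF fF e0.
have iwf := integrable_weight mD iw mf fB.
have iwF n : mu.-integrable D (fun t => (w t * F n t)%:E).
  apply: (@integrable_weight _ _ _ (B + e n)) => // t Dt.
  rewrite -[F n t](subKr (f t)) (le_trans (ler_normB _ _))// lerD ?fB ?fF//.
have H n : `|\int[mu]_(t in D) (w t * f t) - \int[mu]_(t in D) (w t * F n t)| <=
    e n * \int[mu]_(t in D) w t.
  rewrite -RintegralB//; last exact: iwF.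
  have -> : \int[mu]_(t in D) (w t * f t - w t * F n t) = \int[mu]_(t in D) (w t * (f t - F n t)).
    by apply: eq_Rintegral => t _; rewrite mulrBr.
  apply: Rintegral_weight_le => //; first exact: measurable_funB.
  by move=> t Dt; exact: fF.
apply: (cvg_dist_le H); rewrite -[X in _ --> X](mul0r (\int[mu]_(t in D) w t)).
by apply: cvgM => //; exact: cvg_cst.
Qed.
Lemma Rintegral_psum_cvg D w f (c : nat -> R) (r rho : R) : measurable D ->
  mu.-integrable D (EFin \o w) -> (forall t, D t -> 0 <= w t) ->
  measurable_fun D f -> (forall t, D t -> `|f t| <= rho) -> radius_ge r c ->
  0 < rho -> rho < r ->
  \sum_(0 <= k < n) c k * \int[mu]_(t in D) (w t * f t ^+ k) @[n --> \oo] -->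
  \int[mu]_(t in D) (w t * psum c (f t)).
Proof.
move=> mD iw w0 mf frho Hc rho0 rhor.
have [e e0 He] := psum_tail Hc rho0 rhor.
have mfk k : measurable_fun D (fun t => f t ^+ k) by exact: measurable_funX.
have mF n : measurable_fun D (fun t => pseries c (f t) n).
  rewrite /pseries /series/=; apply: measurable_sum => k.
  by apply: measurable_funM => //; exact: measurable_cst.
have mps : measurable_fun D (fun t => psum c (f t)).
  apply: (measurable_fun_cvg mF) => t Dt.
  by apply: (psum_cvg Hc); exact: le_lt_trans (frho t Dt) _.
have iwk k : mu.-integrable D (fun t => (w t * f t ^+ k)%:E).
  apply: (@integrable_weight _ _ _ (rho ^+ k)) => // t Dt.
  by rewrite normrX; apply: lerXn2r; rewrite ?nnegrE ?frho// ltW.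
have pB n t : D t -> `|pseries c (f t) n| <= e 0%N + e n.
  move=> Dt; have := He n _ (frho t Dt); have := He 0%N _ (frho t Dt).
  rewrite {1}/pseries /series/= big_geq// subr0 => h0 hn.
  rewrite -[pseries _ _ _](subKr (psum c (f t))) (le_trans (ler_normB _ _))//.
  exact: lerD.
have SE n : \int[mu]_(t in D) (w t * pseries c (f t) n) =
    \sum_(0 <= k < n) c k * \int[mu]_(t in D) (w t * f t ^+ k).
  elim: n => [|n IH].
    rewrite big_geq//; under eq_Rintegral => t _ do rewrite /pseries /series/= big_geq// mulr0.
    by rewrite Rintegral_cst// mul0r.
  rewrite big_nat_recr//= -IH -RintegralZl//; last exact: iwk.
  rewrite -RintegralD//; last 2 first.
  - exact: (integrable_weight mD iw (mF n) (pB n)).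
  - exact: (integrableZl mD (c n) (iwk n)).
  apply: eq_Rintegral => t _; rewrite /pseries /series/= big_nat_recr//=.
  by rewrite mulrDr; congr (_ + _); rewrite mulrCA.
rewrite -(funext SE).
apply: (@Rintegral_weight_cvg D w _ _ e (e 0%N)) => //.
- move=> t Dt; have := He 0%N _ (frho t Dt).
  by rewrite {1}/pseries /series/= big_geq// subr0.
- by move=> n t Dt; exact: He (frho t Dt).
Qed.

End WeightedIntegrals.

(** * The Caputo derivative of a Jacobi weight *)

Section CaputoEvaluation.
Variable R : realType.
Implicit Types (x p q s t : R) (g : nat -> R).
Local Notation mu := (@lebesgue_measure R).

Lemma psum_scale g (A l : R) x : radius_ge 1 g -> `|l * x| < 1 ->
  psum (fun k => A * (g k * l ^+ k)) x = A * psum g (l * x).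
Proof.
move=> Hg lx; apply/cvg_lim => //.
rewrite (_ : pseries _ x = (fun n => A * pseries g (l * x) n)).
  by apply: cvgM; [exact: cvg_cst|exact: psum_cvg lx].
apply/funext => n; rewrite /pseries /series/= mulr_sumr; apply: eq_bigr => k _.
by rewrite exprMn; ring.
Qed.

Lemma radius_ge_scale g (A : R) (l : R) : 0 < l -> radius_ge 1 g ->
  radius_ge l^-1 (fun k => A * (g k * l ^+ k)).
Proof.
move=> l0 Hg rho rho0 rhol.
have [||M M0 HM] := radius_ge_bound Hg (_ : 0 < l * rho) _; first by rewrite mulr_gt0.
  by rewrite mulrC -ltr_pdivlMr// mul1r.
exists (`|A| * M) => k.
rewrite !normrM -mulrA ler_wpM2l// normrX (gtr0_norm l0) -mulrA -exprMn.
exact: HM.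
Qed.

(** The factor that s^(b+k) acquires when it is differentiated j times. *)
Definition falling (b : R) (j k : nat) : R := \prod_(i < j) (b - i%:R + k%:R).

Lemma radius_ge_falling g b j r : radius_ge r g ->
  radius_ge r (fun k => falling b j k * g k).
Proof.
move=> Hg; elim: j => [|j IH].
  rewrite (_ : (fun _ => _) = g)//; apply/funext => k.
  by rewrite /falling big_ord0 mul1r.
move=> rho rho0 rhor.
have [M M0 HM] := radius_ge_bound IH rho0 rhor.
have [N N0 HN] := radius_ge_bound (radius_ge_shift (radius_ge_diffs IH)) rho0 rhor.
exists (`|b - j%:R| * M + N) => k.
rewrite /falling big_ord_recr/= -/(falling b j k).
have -> : falling b j k * (b - j%:R + k%:R) * g k =
   (b - j%:R) * (falling b j k * g k) + cshift (pseries_diffs (fun k => falling b j k * g k)) k.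
  by case: k => [|k]; rewrite /= /pseries_diffs; ring.
apply: le_trans (ler_wpM2r _ (ler_normD _ _)) _; first by rewrite exprn_ge0 ?ltW.
by rewrite mulrDl lerD// normrM -mulrA ler_wpM2l.
Qed.

(** The functions s^q g(s), with g a power series, are stable under
    differentiation: the k-th coefficient is multiplied by q + k. *)
Lemma is_derive_powR_psum g r q s : radius_ge r g -> 0 < s -> s < r ->
  is_derive s 1 (fun u => u `^ q * psum g u)
    (s `^ (q - 1) * psum (fun k => (q + k%:R) * g k) s).
Proof.
move=> Hg s0 sr; have sr' : `|s| < r by rewrite gtr0_norm.
have Hg1 := radius_ge_diffs Hg.
have := is_derive_mul (is_derive1_powR q s0) (is_derive_psum Hg sr').
congr (is_derive _ _ _ _).
have -> : s `^ q = s `^ (q - 1) * s.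
  by rewrite -{3}[s]powRr1 ?ltW// -powRD_gt0//; congr (_ `^ _); ring.
have -> : psum (fun k => (q + k%:R) * g k) s = q * psum g s + psum (cshift (pseries_diffs g)) s.
  apply/cvg_lim => //.
  rewrite (_ : pseries _ s = (fun n => q * pseries g s n + pseries (cshift (pseries_diffs g)) s n)).
    apply: cvgD; last by apply: psum_cvg sr'; exact: radius_ge_shift.
    by apply: cvgM; [exact: cvg_cst|exact: psum_cvg sr'].
  apply/funext => n; rewrite /pseries /series/= mulr_sumr -big_split/=; apply: eq_bigr => -[|k] _ /=;
    rewrite /pseries_diffs; ring.
by rewrite (psum_shift Hg1 sr'); ring.
Qed.

Lemma derive1n_powR_psum (F : R -> R) g b r (a c : R) j : radius_ge r g -> c - a <= r ->
  (forall t, a < t < c -> F t = (t - a) `^ b * psum g (t - a)) ->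
  forall t, a < t < c ->
    derive1n j F t = (t - a) `^ (b - j%:R) * psum (fun k => falling b j k * g k) (t - a).
Proof.
move=> Hg car FE; elim: j => [|j IH] t /andP[at_ tc].
  rewrite derive1n0 FE ?at_// subr0 (_ : (fun _ => _) = g)//; apply/funext => k.
  by rewrite /falling big_ord0 mul1r.
rewrite derive1nS derive1E.
have ta0 : 0 < t - a by rewrite subr_gt0.
have tr : t - a < r by lra.
have D1 : is_derive t 1 (fun t => t - a) (1 - 0) by apply: is_derive_sub.
have D2 := is_derive_powR_psum (b - j%:R) (radius_ge_falling b j Hg) ta0 tr.
have D := @is_derive_comp _ _ (fun t => t - a) _ _ _ D2 D1.
rewrite (@near_eq_derive _ _ _ _ (fun t => (t - a) `^ (b - j%:R) * psum (fun k => falling b j k * g k) (t - a))).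
- rewrite (@derive_val _ _ _ _ _ _ _ D) subr0 mulr1 -addrA -opprD natr1; congr (_ * psum _ _).
  by apply/funext => k; rewrite /falling big_ord_recr/=; ring.
- near=> u; apply: IH; apply/andP; split; near: u.
  + exact: lt_nbhsr.
  + exact: lt_nbhsl.
Unshelve. all: by end_near. Qed.

Lemma Gamma_rpoch p k : 0 < p -> Gamma (p + k%:R) = rpoch p k * Gamma p.
Proof.
move=> p0; elim: k => [|k IH]; first by rewrite addr0 /rpoch big_ord0 mul1r.
by rewrite -natr1 addrA GammaS ?ltr_wpDr// IH rpochS; ring.
Qed.

(** The factor left by j differentiations is exactly the one by which Gamma of the
    lowered exponent falls short of Gamma of the original one. *)
Lemma Gamma_falling p j k : j%:R - 1 < p ->
  Gamma (p + k%:R + 1) = falling p j k * Gamma (p - j%:R + k%:R + 1).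
Proof.
elim: j => [_|j IH]; first by rewrite subr0 /falling big_ord0 mul1r.
rewrite -natr1 => jp; rewrite IH; last by lra.
rewrite /falling big_ord_recr/= -mulrA; congr (_ * _).
have k0 : 0 <= k%:R :> R by [].
have -> : p - (j%:R + 1) + k%:R + 1 = p - j%:R + k%:R by ring.
by rewrite -GammaS//; lra.
Qed.

(** In terms of s = 1 + t the integrand is the weight s^(P-1) (x-t)^(q-1), with
    P = nu+be-n+1 > 0 and q = n-nu > 0, times a power series of radius 2, and
    s stays below 1 + x < 2.  The k-th term contributes a beta integral, where
    Gamma(P+k) completes the derivative's factor to Gamma(nu+be+1+k); so the ratio
    of Pochhammer symbols of the hypergeometric series appears. *)
Lemma caputo_weight_eval n nu al be x : (0 < n)%N -> n%:R - 1 < nu -> nu < n%:R ->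
  0 < be -> -1 < x -> x < 1 ->
  caputo n nu (- 1) (fun t => (1 - t) `^ (nu + al) * (1 + t) `^ (nu + be)) x =
  2 `^ (nu + al) * (1 + x) `^ be * (Gamma (nu + be + 1) / Gamma (be + 1)) *
  psum (rhyp (- (nu + al)) (nu + be + 1) (be + 1)) ((1 + x) / 2).
Proof.
move=> n0 nu1 nun be0 x1 x1'.
have n1 : 1 <= n%:R :> R by rewrite ler1n.
set p := nu + al; set b := nu + be; set h := rhyp (- p) 1 1.
have Hh : radius_ge 1 h by exact: radius_rhyp.
have V2 : 0 < 2^-1 :> R by rewrite invr_gt0.
pose g k := 2 `^ p * (h k * (2^-1) ^+ k).
have Hg : radius_ge 2 g by rewrite -[2]invrK; exact: radius_ge_scale.
pose F t := (1 - t) `^ p * (1 + t) `^ b.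
have FE t : -1 < t < 1 -> F t = (t - -1) `^ b * psum g (t - -1).
  move=> /andP[t1 t1'].
  have ht : `|2^-1 * (t - -1)| < 1 by rewrite ltr_norml; apply/andP; split; lra.
  rewrite psum_scale// binomial_series// -powRM//; last by lra.
  rewrite /F mulrC; congr (_ `^ _ * _ `^ _); lra.
have car : 1 - (-1) <= 2 :> R by lra.
have DF := @derive1n_powR_psum F g b 2 (-1) 1 n Hg car FE.
set P := b - n%:R + 1; set q := n%:R - nu.
have P0 : 0 < P by rewrite /P /b; lra.
have q0 : 0 < q by rewrite /q; lra.
pose w t := (t - -1) `^ (P - 1) * (x - t) `^ (q - 1).
rewrite /caputo -/F.
have -> : \int[mu]_(t in `]-1, x[) (derive1n n F t / (x - t) `^ (nu + 1 - n%:R)) =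
    \int[mu]_(t in `]-1, x[) (w t * psum (fun k => falling b n k * g k) (t - -1)).
  apply: eq_Rintegral => t; rewrite inE/= in_itv/= => /andP[t1 tx].
  rewrite DF; last by rewrite t1 (lt_trans tx).
  rewrite -powRN /w mulrAC; congr (_ `^ _ * _ `^ _ * _); rewrite /P /q; ring.
have w0 t : 0 <= w t by rewrite mulr_ge0// powR_ge0.
have iw : mu.-integrable `]-1, x[ (EFin \o w) by exact: integrable_beta.
have H : \sum_(0 <= k < m) (falling b n k * g k) *
      \int[mu]_(t in `]-1, x[) (w t * (t - -1) ^+ k) @[m --> \oo] -->
    \int[mu]_(t in `]-1, x[) (w t * psum (fun k => falling b n k * g k) (t - -1)).
  apply: (@Rintegral_psum_cvg _ _ _ mu _ w (fun t => t - -1) _ 2 (1 + x)) => //.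
  - exact: measurable_funB.
  - move=> t /=; rewrite in_itv/= => /andP[t1 tx]; rewrite ger0_norm; lra.
  - exact: radius_ge_falling.
  - lra.
  - lra.
have b0 : 0 < be + 1 by lra.
have B0 : 0 < nu + be + 1 by lra.
have G0 := Gamma_gt0 b0.
set hh := rhyp (- p) (b + 1) (be + 1).
set C := 2 `^ p * (1 + x) `^ be * (Gamma (b + 1) / Gamma (be + 1)).
have T k : falling b n k * g k * \int[mu]_(t in `]-1, x[) (w t * (t - -1) ^+ k) =
    Gamma q * C * (hh k * ((1 + x) / 2) ^+ k).
  have Pk : 0 < P + k%:R by rewrite ltr_wpDr.
  have -> : \int[mu]_(t in `]-1, x[) (w t * (t - -1) ^+ k) =
     \int[mu]_(t in `]-1, x[) ((t - -1) `^ (P + k%:R - 1) * (x - t) `^ (q - 1)).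
    apply: eq_Rintegral => t; rewrite inE/= in_itv/= => /andP[t1 tx].
    have t0 : 0 < t - -1 by lra.
    rewrite /w mulrAC -powR_mulrn ?ltW// -powRD_gt0//.
    by congr (_ `^ _ * _); ring.
  rewrite Rintegral_beta//.
  have -> : x - -1 = 1 + x by lra.
  have -> : P + k%:R + q = be + 1 + k%:R by rewrite /P /q /b; ring.
  have -> : (1 + x) `^ (be + 1 + k%:R - 1) = (1 + x) `^ be * (1 + x) ^+ k.
    rewrite -powR_mulrn; last by lra.
    by rewrite -powRD_gt0; [congr (_ `^ _); ring|lra].
  have GP : falling b n k * Gamma (P + k%:R) = rpoch (b + 1) k * Gamma (b + 1).
    rewrite -Gamma_rpoch; last by rewrite /b; lra.
    rewrite [b + 1 + k%:R]addrAC (@Gamma_falling b n k); last by rewrite /b; lra.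
    by congr (_ * Gamma _); rewrite /P; ring.
  rewrite (@Gamma_rpoch (be + 1))//.
  transitivity ((falling b n k * Gamma (P + k%:R)) * (g k * ((1 + x) `^ be * (1 + x) ^+ k) *
    (Gamma q / (rpoch (be + 1) k * Gamma (be + 1))))); first by ring.
  rewrite GP /g /h /hh /rhyp /C expr_div_n -exprVn.
  by field; rewrite ?gt_eqF ?rpoch_gt0 ?ltr0n ?fact_gt0.
have y1 : `|(1 + x) / 2| < 1 by rewrite ltr_norml; apply/andP; split; lra.
have Hhh : radius_ge 1 hh by exact: radius_rhyp.
have H2 : \sum_(0 <= k < m) (falling b n k * g k) *
      \int[mu]_(t in `]-1, x[) (w t * (t - -1) ^+ k) @[m --> \oo] -->
   Gamma q * C * psum hh ((1 + x) / 2).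
  rewrite (_ : (fun m => _) = (fun m => Gamma q * C * pseries hh ((1 + x) / 2) m)).
    by apply: cvgM; [exact: cvg_cst|exact: psum_cvg y1].
  apply/funext => m; rewrite /pseries /series/= mulr_sumr.
  by apply: eq_bigr => k _; exact: T.
rewrite (cvg_unique _ H H2)// -!mulrA mulKf// gt_eqF//; exact: Gamma_gt0.
Qed.

End CaputoEvaluation.

(** * Uniqueness at the singular point of the hypergeometric equation *)

Section SingularUniqueness.
Variable R : realType.
Implicit Types (t x z : R).

(** Consider the energy E = U^2/t + U'^2.  Dividing by t, rather than taking
    U^2 + U'^2, makes E' contain -(U/t)^2; together with the sign of the singular
    term -(c/t) U'^2, this absorbs the mixed products (U/t) U', and E' <= K E
    remains.  Since U and U' vanish at 0, the mean value theorem shows that E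
    is arbitrarily small near 0, and Gronwall's argument gives E <= 0. *)
Lemma singular_ode_unique (U U1 U2 g h : R -> R) (c M T : R) : 0 <= c ->
  (forall t, 0 <= t < T -> is_derive t 1 U (U1 t)) ->
  (forall t, 0 <= t < T -> is_derive t 1 U1 (U2 t)) ->
  (forall t, 0 < t < T -> t * U2 t = - (c + t * g t) * U1 t - h t * U t) ->
  (forall t, 0 < t < T -> `|g t| <= M /\ `|h t| <= M) ->
  U 0 = 0 -> U1 0 = 0 ->
  forall t, 0 <= t < T -> U t = 0.
Proof.
move=> c0 dU dU1 ode ghM U00 U10 t /andP[]; rewrite le_eqVlt => /orP[/eqP <- //|t0] tT.
have M0 : 0 <= M by have [] := ghM t; [lra|move=> /(le_trans (normr_ge0 _))].
pose E s := U s ^+ 2 / s + U1 s ^+ 2.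
pose E1 s := 2 * (U s / s) * U1 s - (U s / s) ^+ 2 + 2 * U1 s * U2 s.
(* K is what is left after completing the square in U/t. *)
pose K := (1 + M) ^+ 2 + 2 * M.
have dE s : 0 < s < T -> is_derive s 1 E (E1 s).
  move=> /andP[s0 sT]; have hs : 0 <= s < T by lra.
  have s0' : s != 0 by rewrite gt_eqF.
  have di : is_derive s 1 (fun s : R => s^-1) (- 1 / s ^+ 2).
    exact: (@is_derive_inv _ id _ _ _ s0').
  have := is_derive_add (is_derive_mul (is_derive_mul (dU s hs) (dU s hs)) di)
    (is_derive_mul (dU1 s hs) (dU1 s hs)).
  by congr (is_derive _ _ _ _); rewrite /E1; field.
have E1K s : 0 < s < T -> E1 s <= K * E s.
  move=> hs; have [gM hM] := ghM s hs; move/andP: (hs) => [s0 sT].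
  have s0' : s != 0 by rewrite gt_eqF.
  set W := U s / s.
  have UE : U s = W * s by rewrite /W mulfVK.
  have U2E : U2 s = - (c / s) * U1 s - g s * U1 s - h s * W.
    apply: (mulfI s0'); rewrite ode// UE; field.
    exact: s0'.
  have -> : E1 s = 2 * W * U1 s - W ^+ 2 - 2 * (c / s) * U1 s ^+ 2 - 2 * g s * U1 s ^+ 2 - 2 * h s * (W * U1 s).
    by rewrite /E1 U2E -/W; ring.
  have -> : E s = W ^+ 2 * s + U1 s ^+ 2 by rewrite /E UE; field.
  have h1 : 0 <= c / s * U1 s ^+ 2 by rewrite mulr_ge0 ?divr_ge0 ?sqr_ge0// ltW.
  have h2 : - (g s * U1 s ^+ 2) <= M * U1 s ^+ 2.
    rewrite -mulNr; apply: ler_wpM2r; first exact: sqr_ge0.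
    by apply: le_trans gM; rewrite -normrN ler_norm.
  have h3 : W * U1 s - h s * (W * U1 s) <= (1 + M) * `|W| * `|U1 s|.
    apply: (le_trans (ler_norm _)); apply: (le_trans (ler_normB _ _)).
    rewrite !normrM mulrDl mul1r mulrDl lerD2l -!mulrA.
    by apply: ler_wpM2r; rewrite ?mulr_ge0.
  have h4 : 2 * ((1 + M) * `|W| * `|U1 s|) <= W ^+ 2 + (1 + M) ^+ 2 * U1 s ^+ 2.
    rewrite -[W ^+ 2]real_normK ?num_real// -[U1 s ^+ 2]real_normK ?num_real//.
    by have := sqr_ge0 (`|W| - (1 + M) * `|U1 s|); lra.
  have h5 : 0 <= K * (W ^+ 2 * s).
    apply: mulr_ge0; first by rewrite addr_ge0 ?sqr_ge0// mulr_ge0.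
    by apply: mulr_ge0; [exact: sqr_ge0|exact: ltW].
  rewrite mulrDr /K mulrDl in h5 *.
  lra.
(* Gronwall: Phi is nonincreasing. *)
pose Phi s := expR (- (K * s)) * E s.
have dPhi s : 0 < s < T -> is_derive s 1 Phi (expR (- (K * s)) * (E1 s - K * E s)).
  move=> hs.
  have dl : is_derive s 1 (fun s : R => - (K * s)) (- K).
    have := @is_derive_scale _ id s 1 (- K) _.
    rewrite mulr1 (_ : (fun t => - K * id t) = (fun s => - (K * s))); last first.
      by apply/funext => r /=; rewrite mulNr.
    by apply; exact: is_derive_id.
  have de := @is_derive_comp _ expR _ _ _ _ (is_derive_expR _) dl.
  have := is_derive_mul de (dE s hs).
  by congr (is_derive _ _ _ _); ring.
have Phi_dec s : 0 < s < t -> Phi t <= Phi s.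
  move=> /andP[s0 st].
  have [||r rst] := @MVT _ Phi (fun r => expR (- (K * r)) * (E1 r - K * E r)) s t st.
  - by move=> r; rewrite in_itv/= => /andP[sr rt]; apply: dPhi; lra.
  - apply: derivable_within_continuous => r; rewrite in_itv/= => /andP[sr rt].
    by apply: (@ex_derive _ _ _ _ _ _ _ (dPhi r _)); lra.
  move=> Er; rewrite -subr_le0 Er mulr_le0_ge0 ?subr_ge0 ?(ltW st)//.
  rewrite mulr_ge0_le0 ?expR_ge0// subr_le0; apply: E1K.
  by move: rst; rewrite in_itv/=; lra.
have Esmall eta : 0 < eta -> exists2 s, 0 < s < t & E s <= (1 + t) * eta ^+ 2.
  move=> eta0.
  have cU1 : U1 s @[s --> 0] --> U1 0 by apply: (is_derive_continuous (dU1 0 _)); lra.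
  have /cvgrPdist_le/(_ eta eta0)[d /= d0 Hd] := cU1.
  pose s := Num.min (d / 2) (t / 2).
  have s0 : 0 < s by rewrite lt_min; apply/andP; split; lra.
  have sd : s < d by rewrite gt_min; apply/orP; left; lra.
  have st : s < t by rewrite gt_min; apply/orP; right; lra.
  have HU r : 0 <= r <= s -> `|U1 r| <= eta.
    move=> /andP[r0 rs]; have := Hd r; rewrite U10 sub0r normrN; apply.
    by rewrite /ball_/= sub0r normrN ger0_norm// (le_lt_trans rs).
  exists s; first by rewrite s0.
  have [||r rst] := @MVT _ U U1 0 s s0.
  - by move=> r; rewrite in_itv/= => /andP[sr rt]; apply: dU; lra.
  - apply: derivable_within_continuous => r; rewrite in_itv/= => /andP[sr rt].
    by apply: (@ex_derive _ _ _ _ _ _ _ (dU r _)); lra.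
  rewrite U00 !subr0 => Us.
  have hr : `|U1 r| <= eta by apply: HU; move: rst; rewrite in_itv/=; lra.
  have hs : `|U1 s| <= eta by apply: HU; lra.
  have sq y : `|y| <= eta -> y ^+ 2 <= eta ^+ 2.
    by move=> ye; rewrite -[y ^+ 2]real_normK ?num_real// lerXn2r ?nnegrE// ltW.
  rewrite /E Us (_ : (U1 r * s) ^+ 2 / s = s * U1 r ^+ 2); last by field; rewrite gt_eqF.
  have := sq _ hr; have := sq _ hs; move=> h1 h2.
  have : s * U1 r ^+ 2 <= t * eta ^+ 2 by apply: ler_pM => //; rewrite ?sqr_ge0// ltW.
  lra.
have E0 : E t <= 0.
  rewrite leNgt; apply/negP => Et.
  have Pt : 0 < Phi t by rewrite mulr_gt0 ?expR_gt0.
  (* with this eta, the bound (1 + t) eta^2 on E s is at most half of Phi t *)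
  pose eta := Num.min 1 (Phi t / (2 * (1 + t))).
  have t1 : 0 < 1 + t by lra.
  have eta0 : 0 < eta by rewrite lt_min ltr01/= divr_gt0// mulr_gt0.
  have eta1 : eta <= 1 by rewrite ge_min lexx.
  have eta2 : eta <= Phi t / (2 * (1 + t)) by rewrite ge_min lexx orbT.
  have [s hs Es] := Esmall eta eta0.
  have := Phi_dec s hs; apply/negP; rewrite -ltNge.
  have K0 : 0 <= K by rewrite addr_ge0 ?sqr_ge0// mulr_ge0.
  apply: (@le_lt_trans _ _ (E s)).
    have Es0 : 0 <= E s by rewrite addr_ge0 ?divr_ge0 ?sqr_ge0//; lra.
    by rewrite ler_piMl// expR_le1 oppr_le0 mulr_ge0//; lra.
  apply: (le_lt_trans Es).
  have : eta ^+ 2 <= eta by rewrite expr2 ler_piMr// ltW.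
  rewrite ler_pdivlMr in eta2; last by lra.
  move=> e2; have := ler_wpM2l (ltW t1) e2; nra.
have : U t ^+ 2 / t <= 0.
  by apply: le_trans E0; rewrite lerDl sqr_ge0.
rewrite ler_pdivrMr// mul0r => h0.
by apply/eqP; rewrite -sqrf_eq0 eq_le h0 sqr_ge0.
Qed.

End SingularUniqueness.

(** * Euler's and Pfaff's transformations *)

Section Transformations.
Variable R : realType.
Implicit Types (a b c t z A B e : R).

Lemma is_derive_powR_onem e t : t < 1 ->
  is_derive t 1 (fun s : R => (1 - s) `^ e) (- e * (1 - t) `^ e / (1 - t)).
Proof.
move=> t1; have t0 : 0 < 1 - t by lra.
have d1 : is_derive t 1 (fun s : R => 1 - s) (0 - 1) by apply: is_derive_sub.
have := is_derive_pow e d1 t0.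
have -> : (1 - t) `^ e = (1 - t) `^ (e - 1) * (1 - t).
  by rewrite -{3}[1 - t]powRr1 ?ltW// -powRD_gt0//; congr (_ `^ _); ring.
by congr (is_derive _ _ _ _); field; rewrite gt_eqF.
Qed.

Lemma is_derive_inv_onem t : t < 1 -> is_derive t 1 (fun s : R => (1 - s)^-1) (1 / (1 - t) ^+ 2).
Proof.
move=> t1; have d1 : is_derive t 1 (fun s : R => 1 - s) (0 - 1) by apply: is_derive_sub.
have := is_derive_inv d1; rewrite gt_eqF ?subr_gt0// => /(_ isT).
by congr (is_derive _ _ _ _); rewrite sub0r opprK.
Qed.

Lemma rhyp1 a b c : rhyp a b c 1 = a * b / c.
Proof. by rewrite /rhyp /rpoch !big_ord_recr !big_ord0/= !mul1r !addr0 mulr1. Qed.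

Lemma ode_second_order_term a b c t u u1 u2 : 0 < t -> t < 1 ->
  t * (1 - t) * u2 + (c - (a + b + 1) * t) * u1 - a * b * u = 0 ->
  u2 = (a * b * u - (c - (a + b + 1) * t) * u1) / (t * (1 - t)) :> R.
Proof.
move=> t0 t1 H; apply/(canRL (mulfK _)); first by rewrite mulf_neq0 ?gt_eqF ?subr_gt0.
by apply/eqP; rewrite -subr_eq0 -H; apply/eqP; ring.
Qed.

(** The product (1-z)^(A+B-c) u solves the equation with parameters c-A and c-B.
    It agrees at 0 with the series on the right, together with its first derivative.
    Uniqueness is applied on an interval [0, T[ with z < T < 1, where the
    coefficients stay bounded. *)
Lemma euler_transformation A B c z : 0 < c -> 0 <= z -> z < 1 ->
  (1 - z) `^ (A + B - c) * psum (rhyp A B c) z = psum (rhyp (c - A) (c - B) c) z.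
Proof.
move=> c0 z0 z1; set e := A + B - c; set a := c - A; set b := c - B.
set hu := rhyp A B c; set hv := rhyp a b c.
have Hu : radius_ge 1 hu by exact: radius_rhyp.
have Hv : radius_ge 1 hv by exact: radius_rhyp.
have Hu1 := radius_ge_diffs Hu; have Hv1 := radius_ge_diffs Hv.
pose u := psum hu; pose u1 := psum (pseries_diffs hu).
pose u2 := psum (pseries_diffs (pseries_diffs hu)).
pose v := psum hv; pose v1 := psum (pseries_diffs hv).
pose v2 := psum (pseries_diffs (pseries_diffs hv)).
pose X t := (1 - t) `^ e.
pose D t := X t * u t - v t.
pose D1 t := X t * (u1 t - e * (u t * (1 - t)^-1)) - v1 t.
pose D2 t := X t * (u2 t - 2 * e * u1 t / (1 - t) + e * (e - 1) * u t / (1 - t) ^+ 2) - v2 t.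
pose T := (1 + z) / 2.
have zT : z < T by rewrite /T; lra.
have T1 : T < 1 by rewrite /T; lra.
have nt t : 0 <= t < T -> `|t| < 1 by move=> /andP[t0 tT]; rewrite ger0_norm//; lra.
have du t : 0 <= t < T -> is_derive t 1 u (u1 t) by move=> /nt; exact: is_derive_psum.
have du1 t : 0 <= t < T -> is_derive t 1 u1 (u2 t) by move=> /nt; exact: is_derive_psum.
have dv t : 0 <= t < T -> is_derive t 1 v (v1 t) by move=> /nt; exact: is_derive_psum.
have dv1 t : 0 <= t < T -> is_derive t 1 v1 (v2 t) by move=> /nt; exact: is_derive_psum.
pose M := (`|c - a - b - 1| + `|a * b|) / (1 - T).
suff : D z = 0 by rewrite /D => /eqP; rewrite subr_eq0 => /eqP.
apply: (@singular_ode_unique _ D D1 D2 (fun t => (c - a - b - 1) / (1 - t))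
   (fun t => - (a * b) / (1 - t)) c M T).
- exact: ltW.
- move=> t ht; have t1 : t < 1 by lra.
  have := is_derive_sub (is_derive_mul (is_derive_powR_onem e t1) (du t ht)) (dv t ht).
  by congr (is_derive _ _ _ _); rewrite /D1 /X; field; rewrite gt_eqF ?subr_gt0.
- move=> t ht; have t1 : t < 1 by lra.
  have := is_derive_sub (is_derive_mul (is_derive_powR_onem e t1) (is_derive_sub (du1 t ht)
    (is_derive_scale e (is_derive_mul (du t ht) (is_derive_inv_onem t1))))) (dv1 t ht).
  by congr (is_derive _ _ _ _); rewrite /D2 /X; field; rewrite gt_eqF ?subr_gt0.
- move=> t /andP[t0 tT]; have t1 : t < 1 by lra.
  have ht : `|t| < 1 by rewrite gtr0_norm.
  have Eu := ode_second_order_term t0 t1 (hypergeometric_ode A B c0 ht).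
  have Ev := ode_second_order_term t0 t1 (hypergeometric_ode a b c0 ht).
  rewrite /D2 /D1 /D /u2 /v2 Eu Ev -/hu -/hv -/(u1 t) -/(v1 t) -/(u t) -/(v t) /e /a /b.
  by field; rewrite !gt_eqF ?subr_gt0.
- move=> t /andP[t0 tT].
  have tT' : 0 < 1 - t by lra.
  have T0 : 0 < 1 - T by lra.
  have i : (1 - t)^-1 <= (1 - T)^-1 by rewrite lef_pV2 ?posrE//; lra.
  by split; rewrite normrM normfV (gtr0_norm tT') ?normrN /M; apply: ler_pM;
    rewrite ?normr_ge0 ?invr_ge0 ?(ltW tT')// ?lerDl ?lerDr.
- by rewrite /D /X /u /v subr0 powR1 !psum0 /hu /hv !rhyp0; ring.
- rewrite /D1 /X /u /u1 /v1 subr0 powR1 !psum0 /pseries_diffs /hu /hv !rhyp1 rhyp0 /e /a /b.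
  by field; rewrite gt_eqF.
- by rewrite z0 zT.
Qed.

(** In the variable t = -z >= 0, a differentiable solution of the equation with
    parameters c-B and A is determined by its value at 0, as the equation at t = 0
    gives its derivative there.  The function (1+t)^(-A) u(t/(1+t)) is such a
    solution: the map t/(1+t) carries the half line into [0, 1[ and turns one
    equation into the other. *)
Lemma pfaff_unique A B c (phi phi1 phi2 : R -> R) : 0 < c ->
  (forall t, 0 <= t -> is_derive t 1 phi (phi1 t)) ->
  (forall t, 0 <= t -> is_derive t 1 phi1 (phi2 t)) ->
  (forall t, 0 <= t -> t * (1 + t) * phi2 t + (c + (c - B + A + 1) * t) * phi1 t
     + (c - B) * A * phi t = 0) ->
  forall t, 0 <= t -> phi t = phi 0 * ((1 + t) `^ (- A) * psum (rhyp A B c) (t / (1 + t))).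
Proof.
move=> c0 dphi dphi1 ode z z0.
set hu := rhyp A B c.
have Hu : radius_ge 1 hu by exact: radius_rhyp.
have Hu1 := radius_ge_diffs Hu.
pose u := psum hu; pose u1 := psum (pseries_diffs hu).
pose u2 := psum (pseries_diffs (pseries_diffs hu)).
pose X t := (1 + t) `^ (- A).
pose s t := t * (1 + t)^-1.
pose k := phi 0.
pose D t := phi t - k * (X t * u (s t)).
pose D1 t := phi1 t - k * (X t * (u1 (s t) * ((1 + t)^-1 * (1 + t)^-1) - A * (u (s t) * (1 + t)^-1))).
pose D2 t := phi2 t - k * (X t * (u2 (s t) / (1 + t) ^+ 4 - 2 * (1 + A) * u1 (s t) / (1 + t) ^+ 3
   + A * (A + 1) * u (s t) / (1 + t) ^+ 2)).
have s1 t : 0 <= t -> `|s t| < 1.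
  move=> t0; rewrite ger0_norm ?mulr_ge0 ?invr_ge0 ?addr_ge0//.
  by rewrite ltr_pdivrMr ?mul1r; lra.
have tp t : 0 <= t -> 0 < 1 + t by lra.
have tn t : 0 <= t -> 1 + t != 0 by move=> /tp/gt_eqF ->.
have da t : is_derive t 1 (fun t => 1 + t) (0 + 1) by apply: is_derive_add.
have di t : 0 <= t -> is_derive t 1 (fun t => (1 + t)^-1) (- (0 + 1) / (1 + t) ^+ 2).
  by move=> /tn; exact: is_derive_inv.
have ds t : 0 <= t -> is_derive t 1 s ((1 + t)^-1 * (1 + t)^-1).
  move=> t0; have := is_derive_mul (is_derive_id t 1) (di t t0).
  by congr (is_derive _ _ _ _); field; exact: tn.
have dX t : 0 <= t -> is_derive t 1 X (- A * X t / (1 + t)).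
  move=> t0; have := is_derive_pow (- A) (da t) (tp t t0).
  have -> : X t = (1 + t) `^ (- A - 1) * (1 + t).
    rewrite /X -{3}[1 + t]powRr1 ?ltW ?tp// -powRD_gt0 ?tp//; congr (_ `^ _); ring.
  by congr (is_derive _ _ _ _); field; exact: tn.
have du t : 0 <= t -> is_derive t 1 (fun t => u (s t)) (u1 (s t) * ((1 + t)^-1 * (1 + t)^-1)).
  by move=> t0; exact: (@is_derive_comp _ u s _ _ _ (is_derive_psum Hu (s1 t t0)) (ds t t0)).
have du1 t : 0 <= t -> is_derive t 1 (fun t => u1 (s t)) (u2 (s t) * ((1 + t)^-1 * (1 + t)^-1)).
  by move=> t0; exact: (@is_derive_comp _ u1 s _ _ _ (is_derive_psum Hu1 (s1 t t0)) (ds t t0)).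
suff : D z = 0 by rewrite /D => /eqP; rewrite subr_eq0 => /eqP.
have s0 : s 0 = 0 by rewrite /s mul0r.
pose M := `|(c - B) + A + 1 - c| + `|(c - B) * A|.
apply: (@singular_ode_unique _ D D1 D2 (fun t => (c - B + A + 1 - c) / (1 + t))
   (fun t => ((c - B) * A) / (1 + t)) c M (z + 1)).
- exact: ltW.
- move=> t /andP[t0 _].
  have := is_derive_sub (dphi t t0) (is_derive_scale k (is_derive_mul (dX t t0) (du t t0))).
  by congr (is_derive _ _ _ _); rewrite /D1; field; exact: tn.
- move=> t /andP[t0 _].
  have := is_derive_sub (dphi1 t t0) (is_derive_scale k (is_derive_mul (dX t t0)
    (is_derive_sub (is_derive_mul (du1 t t0) (is_derive_mul (di t t0) (di t t0)))
      (is_derive_scale A (is_derive_mul (du t t0) (di t t0)))))).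
  by congr (is_derive _ _ _ _); rewrite /D2; field; exact: tn.
- move=> t /andP[t0 _]; have t0' := ltW t0.
  have st0 : 0 < s t by rewrite mulr_gt0 ?invr_gt0 ?tp.
  have st1 : s t < 1 by have := s1 t t0'; rewrite gtr0_norm.
  have Eu := ode_second_order_term st0 st1 (hypergeometric_ode A B c0 (s1 t t0')).
  have Ep : phi2 t = - ((c + (c - B + A + 1) * t) * phi1 t + (c - B) * A * phi t) / (t * (1 + t)).
    apply/(canRL (mulfK _)); first by rewrite mulf_neq0 ?gt_eqF ?tp.
    by apply/eqP; rewrite -subr_eq0 -(ode t t0'); apply/eqP; ring.
  rewrite /D2 /D1 /D Ep /u2 Eu -/hu -/(u1 (s t)) -/(u (s t)).
  have -> : 1 - s t = (1 + t)^-1 by rewrite /s; field; exact: tn.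
  have := tn t t0'; have : t != 0 by rewrite gt_eqF.
  move: (u1 (s t)) (u (s t)) (X t) => y1 y Y t0n tn1; rewrite /s.
  by field; rewrite ?t0n ?tn1 ?invr_neq0.
- move=> t /andP[t0 _].
  have i : (1 + t)^-1 <= 1 by rewrite invf_le1 ?tp ?ltW//; lra.
  have i0 : 0 <= (1 + t)^-1 by rewrite invr_ge0 ltW ?tp ?ltW.
  split; rewrite normrM (ger0_norm i0); apply: (le_trans (ler_piMr _ i));
    by rewrite ?normr_ge0 /M ?lerDl ?lerDr.
- by rewrite /D /X s0 addr0 powR1 /u psum0 /hu rhyp0 /k; ring.
- have := ode 0 (lexx 0); rewrite /D1 /X s0 addr0 powR1 /u1 /u !psum0 /pseries_diffs /hu rhyp1 rhyp0 /k.
  rewrite !(mulr0, mul0r, add0r, addr0) => h.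
  have -> : phi1 0 = - ((c - B) * A * phi 0) / c.
    move: h; move: (phi1 0) (phi 0) => p1 p0 h.
    apply/(canRL (mulfK _)); first by rewrite gt_eqF.
    by apply/eqP; rewrite -subr_eq0 -h; apply/eqP; ring.
  by field; rewrite gt_eqF.
- by rewrite z0 ltrDl ltr01.
Qed.

End Transformations.

(** * Real analytic functions and the identity theorem *)

Section RealAnalytic.
Variable R : realType.
Implicit Types (t x r : R) (phi psi : R -> R) (u v : nat -> R).

Definition ranalytic_at phi t0 := exists u r,
  [/\ 0 < r, radius_ge r u & forall t, `|t - t0| < r -> phi t = psum u (t - t0)].

Lemma radius_ge_le r r' u : r' <= r -> radius_ge r u -> radius_ge r' u.
Proof. by move=> rr H rho rho0 rhor; apply: H => //; exact: lt_le_trans rr. Qed.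

Lemma radius_ge_lin r a b u v : radius_ge r u -> radius_ge r v ->
  radius_ge r (fun k => a * u k + b * v k).
Proof.
move=> Hu Hv rho rho0 rhor.
have [M M0 HM] := radius_ge_bound Hu rho0 rhor.
have [N N0 HN] := radius_ge_bound Hv rho0 rhor.
exists (`|a| * M + `|b| * N) => k.
apply: le_trans (ler_wpM2r _ (ler_normD _ _)) _; first by rewrite exprn_ge0 ?ltW.
by rewrite mulrDl !normrM -!mulrA lerD ?ler_wpM2l.
Qed.

Lemma psum_lin r a b u v x : radius_ge r u -> radius_ge r v -> `|x| < r ->
  psum (fun k => a * u k + b * v k) x = a * psum u x + b * psum v x.
Proof.
move=> Hu Hv xr; apply/cvg_lim => //.
rewrite (_ : pseries _ x = (fun n => a * pseries u x n + b * pseries v x n)).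
  by apply: cvgD; apply: cvgM; (try exact: cvg_cst); apply: psum_cvg xr.
apply/funext => n; rewrite /pseries /series/= !mulr_sumr -big_split/=.
by apply: eq_bigr => k _; ring.
Qed.

Lemma ranalytic_lin a b phi psi t0 : ranalytic_at phi t0 -> ranalytic_at psi t0 ->
  ranalytic_at (fun t => a * phi t + b * psi t) t0.
Proof.
move=> [u [r [r0 Hu phiE]]] [v [r' [r0' Hv psiE]]].
have m0 : 0 < Num.min r r' by rewrite lt_min r0.
have Hu' : radius_ge (Num.min r r') u by apply: radius_ge_le Hu; rewrite ge_min lexx.
have Hv' : radius_ge (Num.min r r') v by apply: radius_ge_le Hv; rewrite ge_min lexx orbT.
exists (fun k => a * u k + b * v k), (Num.min r r'); split => //.
  exact: radius_ge_lin.
move=> t ht; rewrite (psum_lin _ _ Hu' Hv')//.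
by move: ht; rewrite lt_min => /andP[h1 h2]; rewrite phiE// psiE.
Qed.

Lemma ranalytic_mulX phi t0 : ranalytic_at phi t0 -> ranalytic_at (fun t => t * phi t) t0.
Proof.
move=> [u [r [r0 Hu phiE]]].
exists (fun k => t0 * u k + 1 * cshift u k), r; split => //.
  by apply: radius_ge_lin => //; exact: radius_ge_shift.
move=> t ht; rewrite (psum_lin _ _ Hu (radius_ge_shift Hu))// (psum_shift Hu)// phiE//; ring.
Qed.

Lemma ranalytic_is_derive phi t0 u r t : radius_ge r u ->
  (forall t, `|t - t0| < r -> phi t = psum u (t - t0)) -> `|t - t0| < r ->
  is_derive t 1 phi (psum (pseries_diffs u) (t - t0)).
Proof.
move=> Hu phiE ht.
have D1 : is_derive t 1 (fun t => t - t0) (1 - 0) by apply: is_derive_sub.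
have D := @is_derive_comp _ _ (fun t => t - t0) _ _ _ (is_derive_psum Hu ht) D1.
have [d1 d2] := D.
have NE : \forall s \near t, phi s = psum u (s - t0).
  have r0 : 0 < r - `|t - t0| by rewrite subr_gt0.
  near=> s; apply: phiE.
  have : `|t - s| < r - `|t - t0| by near: s; apply/nbhs_ballP; exists (r - `|t - t0|).
  have := ler_distD t s t0; rewrite (distrC t s); lra.
have NE' : \forall s \near t, psum u (s - t0) = phi s by near=> s; apply/esym; near: s.
apply: DeriveDef.
  by apply: (@near_eq_derivable _ _ _ (fun s => psum u (s - t0))).
by rewrite (@near_eq_derive _ _ _ _ (fun s => psum u (s - t0)))// d2 subr0 mulr1.
Unshelve. all: by end_near. Qed.

Lemma ranalytic_derive1 phi t0 : ranalytic_at phi t0 ->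
  is_derive t0 1 phi (derive1 phi t0) /\ ranalytic_at (derive1 phi) t0.
Proof.
move=> [u [r [r0 Hu phiE]]]; split.
  have h : `|t0 - t0| < r by rewrite subrr normr0.
  have D := ranalytic_is_derive Hu phiE h.
  by rewrite derive1E (@derive_val _ _ _ _ _ _ _ D).
exists (pseries_diffs u), r; split => //; first exact: radius_ge_diffs.
move=> t ht; rewrite derive1E.
exact: (@derive_val _ _ _ _ _ _ _ (ranalytic_is_derive Hu phiE ht)).
Qed.

(** A series that vanishes on the left of 0 has constant term 0 by continuity; the
    other coefficients follow by dividing out the variable. *)
Lemma psum_zero_left0 r u delta : radius_ge r u -> 0 < delta -> delta <= r ->
  (forall x, 0 < x < delta -> psum u (- x) = 0) -> u 0%N = 0.
Proof.
move=> Hu d0 dr H0.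
have r0 : `|0 : R| < r by rewrite (@normr0 R R); exact: lt_le_trans dr.
have /is_derive_continuous C := is_derive_psum Hu r0.
have {}C : psum u x @[x --> 0] --> psum u 0 by exact: C.
apply/eqP; rewrite -normr_le0; apply/ler_addgt0Pr => eps eps0; rewrite add0r.
move/cvgrPdist_le : C => /(_ eps eps0)[e /= e0 He].
pose x := Num.min (e / 2) (delta / 2).
have x0 : 0 < x by rewrite lt_min; apply/andP; split; lra.
have xe : x < e by rewrite gt_min; apply/orP; left; lra.
have xd : x < delta by rewrite gt_min; apply/orP; right; lra.
have := He (- x); rewrite /ball_/= opprK add0r gtr0_norm// => /(_ xe).
by rewrite H0 ?x0// psum0 subr0.
Qed.

Lemma psum_zero_left r u delta : radius_ge r u -> 0 < delta -> delta <= r ->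
  (forall x, 0 < x < delta -> psum u (- x) = 0) -> forall k, u k = 0.
Proof.
move=> Hu d0 dr; move=> + k; elim: k u Hu => [|k IH] u Hu H0.
  exact: (psum_zero_left0 Hu d0 dr H0).
have Hu1 : radius_ge r (fun k => u k.+1).
  move=> rho rho0 rhor; have [M M0 HM] := radius_ge_bound Hu rho0 rhor.
  exists (M / rho) => j; rewrite ler_pdivlMr// -mulrA -exprSr; exact: HM.
have u00 := psum_zero_left0 Hu d0 dr H0.
apply: (IH _ Hu1) => x /andP[x0 xd].
have xr : `|- x| < r by rewrite normrN gtr0_norm// (lt_le_trans xd).
have := psum_shift Hu1 xr.
rewrite (_ : cshift _ = u); last by apply/funext => -[|j].
rewrite H0 ?x0// => /esym/eqP; rewrite mulf_eq0 oppr_eq0 gt_eqF//= => /eqP.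
exact.
Qed.

(** Let m be the supremum of the t such that L vanishes on [0, t].  The expansion
    of L at m vanishes to the left of m, hence its coefficients do, hence L
    vanishes beyond m. *)
Lemma ranalytic_identity (L : R -> R) delta : 0 < delta ->
  (forall t, 0 <= t -> ranalytic_at L t) -> (forall t, 0 <= t < delta -> L t = 0) ->
  forall t, 0 <= t -> L t = 0.
Proof.
move=> d0 HL L0 t1 t10; apply/eqP/negPn/negP => Lt1.
pose S : set R := [set t | 0 <= t <= t1 /\ forall s, 0 <= s <= t -> L s = 0].
have t1d : delta <= t1.
  by rewrite leNgt; apply: contra Lt1 => h; rewrite L0// t10.
have S0 : S 0.
  by split; [lra|move=> s hs; apply: L0; lra].
have Sub : has_sup S.
  by split; [exists 0|exists t1 => t [] /andP[]].
set m := sup S.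
have mle t : S t -> t <= m by move=> St; apply: ub_le_sup => //; case: Sub.
have m0 : delta / 2 <= m.
  by apply: mle; split; [lra|move=> s hs; apply: L0; lra].
have mt1 : m <= t1 by apply: ge_sup => [|t [] /andP[]//]; exists 0.
have Lm s : 0 <= s < m -> L s = 0.
  move=> /andP[s0 sm].
  have [t [_ St] st] : exists2 t, S t & s < t.
    by apply: sup_gt => //; case: Sub.
  by apply: St; rewrite s0 ltW.
have [u [r [r0 Hu LE]]] := HL m ltac:(lra).
pose e := Num.min r m.
have e0 : 0 < e by rewrite lt_min r0; lra.
have er : e <= r by rewrite ge_min lexx.
have em : e <= m by rewrite ge_min lexx orbT.
have uz : forall k, u k = 0.
  apply: (psum_zero_left Hu e0 er) => x /andP[x0 xe].
  have := LE (m - x); rewrite addrAC subrr add0r normrN gtr0_norm// => <-; last by lra.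
  by apply: Lm; lra.
have LZ s : `|s - m| < r -> L s = 0.
  move=> hs; rewrite LE//; apply/cvg_lim => //.
  rewrite (_ : pseries _ _ = cst 0); first exact: cvg_cst.
  by apply/funext => n; rewrite /pseries /series/= big1// => k _; rewrite uz mul0r.
have [h|h] := leP t1 (m + r / 2).
  move: Lt1; rewrite LZ ?eqxx// ger0_norm; lra.
have : m + r / 2 <= m.
  apply: mle; split; first by lra.
  move=> s /andP[s0 s1]; have [sm|sm] := ltP s m; first by apply: Lm; rewrite s0.
  by apply: LZ; rewrite ger0_norm; lra.
lra.
Qed.

End RealAnalytic.

(** * Complex power series at real arguments *)

Section ComplexSeries.
Variable R : realType.
Local Notation Re := (@complex.Re R).
Local Notation Im := (@complex.Im R).
Implicit Types (x y z : R[i]).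

Lemma ReM x y : Re (x * y) = Re x * Re y - Im x * Im y.
Proof. by case: x y => a b [c d]. Qed.

Lemma ImM x y : Im (x * y) = Re x * Im y + Im x * Re y.
Proof. by case: x y => a b [c d]. Qed.

Lemma ReB x y : Re (x - y) = Re x - Re y.
Proof. by case: x y => a b [c d]. Qed.

Lemma ImB x y : Im (x - y) = Im x - Im y.
Proof. by case: x y => a b [c d]. Qed.

Lemma complex_eqP x y : Re x = Re y -> Im x = Im y -> x = y.
Proof. by case: x y => a b [c d] /= -> ->. Qed.

Lemma normc_ge_Im x : `|Im x|%:C <= `|x|.
Proof.
rewrite normc_def lecR -sqrtr_sqr ler_sqrt ?addr_ge0 ?sqr_ge0//.
by rewrite lerDr sqr_ge0.
Qed.

Lemma normc_le_Re_Im x : `|x| <= (`|Re x| + `|Im x|)%:C.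
Proof.
rewrite [in leLHS](complexE x); apply: le_trans (ler_normD _ _) _.
rewrite rmorphD/= lerD// ?normrM.
- by rewrite normc_def/= expr0n addr0 sqrtr_sqr.
- rewrite [`|'i%C|]normc_def/= expr0n add0r expr1n sqrtr1 mul1r.
  by rewrite normc_def/= expr0n addr0 sqrtr_sqr.
Qed.

Lemma norm_real_complex (a : R) : `|a%:C| = `|a|%:C.
Proof. by rewrite normc_def/= expr0n addr0 sqrtr_sqr. Qed.

Lemma pos_complex_real z : 0 < z -> z = (Re z)%:C.
Proof. by rewrite ltcE/=; case: z => a b /= /andP[/eqP -> _]. Qed.

Lemma cvg_dist_leC (u : nat -> R[i]) (l : R[i]) (e : nat -> R) :
  (forall n, `|l - u n| <= (e n)%:C) -> e @ \oo --> (0 : R) ->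
  (u : nat -> R[i]^o) @ \oo --> (l : R[i]^o).
Proof.
move=> H e0; apply/cvgrPdist_le => eps eps0.
move: (eps0); rewrite (pos_complex_real eps0) ltcR => eps0'.
have [N _ HN] : \forall n \near \oo, e n <= Re eps by apply: (cvgr_le _ e0).
exists N => // n /= Nn; apply: le_trans (H n) _.
by rewrite lecR; exact: HN.
Qed.

Lemma cvg_Re (u : nat -> R[i]) (l : R[i]) :
  (u : nat -> R[i]^o) @ \oo --> (l : R[i]^o) -> Re (u n) @[n --> \oo] --> Re l.
Proof.
move=> H; apply/cvgrPdist_le => eps eps0.
move/cvgrPdist_le : H => /(_ eps%:C); rewrite ltcR => /(_ eps0).
apply: filterS => n h; rewrite -lecR; apply: le_trans h.
by rewrite -ReB; exact: normc_ge_Re.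
Qed.

Lemma cvg_Im (u : nat -> R[i]) (l : R[i]) :
  (u : nat -> R[i]^o) @ \oo --> (l : R[i]^o) -> Im (u n) @[n --> \oo] --> Im l.
Proof.
move=> H; apply/cvgrPdist_le => eps eps0.
move/cvgrPdist_le : H => /(_ eps%:C); rewrite ltcR => /(_ eps0).
apply: filterS => n h; rewrite -lecR; apply: le_trans h.
by rewrite -ImB; exact: normc_ge_Im.
Qed.

Lemma Re_sum (I : Type) (r : seq I) (f : I -> R[i]) :
  Re (\sum_(i <- r) f i) = \sum_(i <- r) Re (f i).
Proof. by apply: (big_morph Re) => // -[a b] [c d]. Qed.

Lemma Im_sum (I : Type) (r : seq I) (f : I -> R[i]) :
  Im (\sum_(i <- r) f i) = \sum_(i <- r) Im (f i).
Proof. by apply: (big_morph Im) => // -[a b] [c d]. Qed.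

Lemma ReMr x (a : R) : Re (x * a%:C) = Re x * a.
Proof. by rewrite ReM/= mulr0 subr0. Qed.

Lemma ImMr x (a : R) : Im (x * a%:C) = Im x * a.
Proof. by rewrite ImM/= mulr0 add0r. Qed.

Lemma csums_Re (u : nat -> R[i]) (t : R) (l : R[i]) : csums u t%:C l -> pseries (Re \o u) t @ \oo --> Re l.
Proof.
move=> /cvg_Re; apply: cvg_trans; apply: near_eq_cvg; apply: nearW => n.
rewrite /pseries /series/= Re_sum; apply: eq_bigr => k _.
by rewrite -rmorphXn/= ReMr.
Qed.

Lemma csums_Im (u : nat -> R[i]) (t : R) (l : R[i]) : csums u t%:C l -> pseries (Im \o u) t @ \oo --> Im l.
Proof.
move=> /cvg_Im; apply: cvg_trans; apply: near_eq_cvg; apply: nearW => n.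
rewrite /pseries /series/= Im_sum; apply: eq_bigr => k _.
by rewrite -rmorphXn/= ImMr.
Qed.

Lemma csums_real (c : nat -> R) (t l : R) : pseries c t @ \oo --> l ->
  csums (fun k => (c k)%:C) t%:C l%:C.
Proof.
move=> H; apply: (@cvg_dist_leC _ _ (fun n => `|l - pseries c t n|)).
  move=> n; rewrite /series/=.
  have -> : \sum_(0 <= k < n) (c k)%:C * t%:C ^+ k = (pseries c t n)%:C.
    rewrite /pseries /series/= rmorph_sum; apply: eq_bigr => k _.
    by rewrite rmorphM rmorphXn.
  by rewrite -rmorphB/= norm_real_complex.
rewrite -(@normr0 R R) -(subrr l); apply: cvg_norm; apply: cvgB => //; exact: cvg_cst.
Qed.

Lemma csums_unique (u : nat -> R[i]) (w l m : R[i]) : csums u w l -> csums u w m -> l = m.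
Proof.
by move=> H1 H2; apply: complex_eqP; [apply: (cvg_unique _ (cvg_Re H1) (cvg_Re H2))
  |apply: (cvg_unique _ (cvg_Im H1) (cvg_Im H2))].
Qed.

Lemma pochhammer_real (a : R) k : pochhammer a%:C k = (rpoch a k)%:C.
Proof.
rewrite /pochhammer /rpoch rmorph_prod; apply: eq_bigr => i _.
by rewrite rmorphD/= rmorph_nat.
Qed.

Lemma hyp2F1_coef_real (a b c : R) k :
  hyp2F1_coef a%:C b%:C c%:C k = (rhyp a b c k)%:C.
Proof.
rewrite /hyp2F1_coef /rhyp !pochhammer_real fmorph_div !rmorphM/= rmorph_nat.
by [].
Qed.

Lemma rhyp_sym (a b c : R) : rhyp a b c = rhyp b a c.
Proof. by apply/funext => k; rewrite /rhyp [rpoch a k * _]mulrC. Qed.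

Lemma hyp2F1_disc (a b c : R) F (t : R) : 0 < c -> is_hyp2F1 a%:C b%:C c%:C F ->
  `|t| < 1 -> F t%:C = (psum (rhyp a b c) t)%:C.
Proof.
move=> c0 [H _] t1; apply: (csums_unique (H _ _)).
  by rewrite norm_real_complex ltcR.
rewrite (_ : hyp2F1_coef _ _ _ = (fun k => (rhyp a b c k)%:C)); last first.
  by apply/funext => k; exact: hyp2F1_coef_real.
by apply: csums_real; apply: psum_cvg t1; exact: radius_rhyp.
Qed.

Lemma slit_plane_nonpos (t : R) : 0 <= t -> slit_plane (- t)%:C.
Proof. by move=> t0 [s s1 /complexI ts]; lra. Qed.

(** The variable t runs against the axis, so the coefficients change sign
    alternately. *)
Lemma canalytic_ranalytic (F : R[i] -> R[i]) (t0 : R) : canalytic_at F (- t0)%:C ->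
  ranalytic_at (fun t => Re (F (- t)%:C)) t0 /\ ranalytic_at (fun t => Im (F (- t)%:C)) t0.
Proof.
move=> [u [r [r0 H]]].
have H' t : `|t - t0| < r -> csums u (- (t - t0))%:C (F (- t)%:C).
  move=> tr; have -> : (- (t - t0))%:C = (- t)%:C - (- t0)%:C.
    by rewrite -rmorphB/=; congr (_%:C); ring.
  by apply: H; rewrite -rmorphB/= norm_real_complex ltcR opprK addrC distrC.
have alt (c : nat -> R) t : pseries c (- t) = pseries (fun k => c k * (-1) ^+ k) t.
  apply/funext => n; rewrite /pseries /series/=; apply: eq_bigr => k _.
  by rewrite -mulrA -exprMn mulN1r.
split.
- exists (fun k => Re (u k) * (-1) ^+ k), r; split => //.
    apply: cvg_radius_ge => s s0 sr; rewrite -alt; apply: cvgP.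
    have := H' (s + t0); rewrite addrK gtr0_norm// => /(_ sr) /csums_Re; apply.
  by move=> t /H' /csums_Re; rewrite alt => /cvg_lim <-.
- exists (fun k => Im (u k) * (-1) ^+ k), r; split => //.
    apply: cvg_radius_ge => s s0 sr; rewrite -alt; apply: cvgP.
    have := H' (s + t0); rewrite addrK gtr0_norm// => /(_ sr) /csums_Im; apply.
  by move=> t /H' /csums_Im; rewrite alt => /cvg_lim <-.
Qed.

End ComplexSeries.

(** * Contiguous relations between analytic continuations *)

Section Contiguity.
Variable R : realType.
Implicit Types (a b c : R) (u v : nat -> R[i]) (w l m s z : R[i]).

Lemma csums_lin u v w l m s : csums u w l -> csums v w m ->
  csums (fun k => u k + s * v k) w (l + s * m).
Proof.
move=> Hu Hv; rewrite /csums.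
rewrite (_ : series _ = (fun n => (series (fun k => u k * w ^+ k : R[i]^o) n : R[i]^o) +
   (s : R[i]) *: (series (fun k => v k * w ^+ k : R[i]^o) n : R[i]^o))).
  apply: (@cvgD _ R[i]^o _ _ _ _ _ _ _ Hu).
  exact: (@cvgZl_tmp _ R[i]^o _ _ _ s _ _ Hv).
apply/funext => n; rewrite /series/= scaler_sumr -big_split/=; apply: eq_bigr => k _.
by rewrite mulrDl /GRing.scale/= mulrA.
Qed.

Definition ccshift u k : R[i] := if k is k'.+1 then u k' else 0.

Lemma csums_shift u w l : csums u w l -> csums (ccshift u) w (w * l).
Proof.
move=> Hu; rewrite /csums -cvg_shiftS.
rewrite (_ : (fun n => _) = (fun n => (w : R[i]) *: (series (fun k => u k * w ^+ k : R[i]^o) n : R[i]^o))).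
  by apply: cvgZl_tmp.
apply/funext => n; rewrite /series/= big_nat_recl//= mul0r add0r scaler_sumr.
by apply: eq_bigr => k _; rewrite /GRing.scale/= exprS mulrCA.
Qed.

Lemma canalytic_contiguous (F G : R[i] -> R[i]) s z0 : canalytic_at F z0 -> canalytic_at G z0 ->
  canalytic_at (fun z => F z + s * (z * G z)) z0.
Proof.
move=> [u [r [r0 Hu]]] [v [r' [r0' Hv]]].
exists (fun k => u k + s * (ccshift v k + z0 * v k)), (Num.min r r'); split.
  by rewrite lt_min r0.
move=> z zr.
have hr : `|z - z0| < r%:C by apply: (lt_le_trans zr); rewrite lecR ge_min lexx.
have hr' : `|z - z0| < r'%:C by apply: (lt_le_trans zr); rewrite lecR ge_min lexx orbT.
apply: csums_lin; first exact: Hu.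
have -> : z * G z = (z - z0) * G z + z0 * G z by rewrite -mulrDl subrK.
by apply: csums_lin; [apply: csums_shift; exact: Hv|exact: Hv].
Qed.

Lemma rpoch_shift a k : rpoch a k.+1 = a * rpoch (a + 1) k.
Proof.
rewrite /rpoch big_ord_recl addr0; congr (_ * _); apply: eq_bigr => i _.
by rewrite /bump/= natrD addrA.
Qed.

(** Since (a)_k = (a+1)_k - k (a+1)_(k-1), the parameter a is lowered at the price of a
    shifted series. *)
Lemma rhyp_contiguous a b c k : 0 < c -> rhyp a b c k =
  rhyp (a + 1) b c k + - (b / c) * cshift (rhyp (a + 1) (b + 1) (c + 1)) k.
Proof.
move=> c0; case: k => [|k] /=; first by rewrite !rhyp0 mulr0 addr0.
have c1 : 0 < c + 1 by rewrite addr_gt0.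
rewrite /rhyp (rpochS (a + 1)) (rpoch_shift a) (rpoch_shift b) (rpoch_shift c) factS natrM.
field; rewrite !gt_eqF ?rpoch_gt0 ?ltr0n ?fact_gt0//.
Qed.

Definition has_hyp2F1 a b c := exists F, is_hyp2F1 a%:C b%:C c%:C F.

Lemma has_hyp2F1_sym a b c : has_hyp2F1 a b c -> has_hyp2F1 b a c.
Proof.
move=> [F [H1 H2]]; exists F; split => // z /H1.
by congr (csums _ _ _); apply/funext => k; rewrite !hyp2F1_coef_real rhyp_sym.
Qed.

(** The contiguous relation is an identity of power series at 0; its right-hand side
    continues analytically wherever the two functions in it do. *)
Lemma has_hyp2F1_contiguous a b c : 0 < c ->
  has_hyp2F1 (a + 1) b c -> has_hyp2F1 (a + 1) (b + 1) (c + 1) -> has_hyp2F1 a b c.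
Proof.
move=> c0 [F [F1 F2]] [G [G1 G2]].
exists (fun z => F z + (- (b / c))%:C * (z * G z)); split; last first.
  by move=> z hz; apply: canalytic_contiguous; [exact: F2|exact: G2].
move=> z z1.
rewrite (_ : hyp2F1_coef _ _ _ = (fun k => hyp2F1_coef (a + 1)%:C b%:C c%:C k +
   (- (b / c))%:C * ccshift (hyp2F1_coef (a + 1)%:C (b + 1)%:C (c + 1)%:C) k)).
  by apply: csums_lin; [exact: F1|apply: csums_shift; exact: G1].
apply/funext => k; rewrite !hyp2F1_coef_real rhyp_contiguous//.
have RD (x1 x2 x3 : R) : (x1 + x2 * x3)%:C = x1%:C + x2%:C * x3%:C by rewrite rmorphD rmorphM.
by rewrite RD; case: k => [|k]; rewrite /= ?hyp2F1_coef_real.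
Qed.

End Contiguity.

(** * The binomial series of a negative integral power *)

Section NegativeBinomial.
Variable R : realType.
Implicit Types (m k K : nat) (w : R[i]).

(** The coefficient (m)_k/k! of w^k in (1-w)^(-m). *)
Definition nbin m k : R := rhyp m%:R 1 1 k.

Lemma nbinE m k : nbin m k = rpoch m%:R k / k`!%:R.
Proof.
rewrite /nbin /rhyp; field.
by rewrite !gt_eqF ?rpoch_gt0 ?ltr0n ?fact_gt0.
Qed.

Lemma nbin0 m : nbin m 0 = 1. Proof. exact: rhyp0. Qed.

Lemma nbin_ge0 m k : 0 <= nbin m k.
Proof.
rewrite nbinE divr_ge0//; apply: prodr_ge0 => i _; exact: addr_ge0.
Qed.

Lemma nbin_pascal m k : nbin m.+1 k.+1 = nbin m k.+1 + nbin m.+1 k.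
Proof.
rewrite !nbinE rpochS (rpoch_shift m%:R) natr1 factS natrM -[m.+1%:R]natr1.
by field; rewrite nat1r !gt_eqF ?ltr0n ?fact_gt0.
Qed.

Definition nbin_sum m K w : R[i] := \sum_(0 <= k < K) (nbin m k)%:C * w ^+ k.
Definition nbin_rem m K w : R[i] := (1 - w) ^- m - nbin_sum m K w.

Lemma nbin_sum_pascal m K w :
  (1 - w) * nbin_sum m.+1 K.+1 w = nbin_sum m K.+1 w - (nbin m.+1 K)%:C * w ^+ K.+1.
Proof.
rewrite /nbin_sum; elim: K => [|K IH].
  by rewrite !big_nat1 !nbin0 !mulr1 expr1 mul1r.
rewrite big_nat_recr//= mulrDr IH [in RHS]big_nat_recr//= nbin_pascal rmorphD/= (exprS _ K.+1).
ring.
Qed.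

(** Pascal's rule, multiplied out: the remainders satisfy a recurrence in m with
    nonnegative coefficients. *)
Lemma nbin_remS m K w : 1 - w != 0 ->
  nbin_rem m.+1 K.+1 w = (nbin_rem m K.+1 w + (nbin m.+1 K)%:C * w ^+ K.+1) / (1 - w).
Proof.
move=> w1; apply/(canRL (mulfK w1)).
rewrite /nbin_rem mulrBl [nbin_sum m.+1 _ _ * _]mulrC nbin_sum_pascal exprS invfM mulrAC mulVf// mul1r.
ring.
Qed.

Lemma nbin_rem0S K w : nbin_rem 0 K.+1 w = 0.
Proof.
rewrite /nbin_rem expr0 invr1 /nbin_sum big_nat_recl//= nbin0 mulr1 big1 ?addr0 ?subrr// => k _.
by rewrite nbinE (rpoch_shift 0) mul0r mul0r mul0r.
Qed.

(** On the disc of radius rho one has |1-w| >= 1-rho; by the recurrence, the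
    remainder at rho itself therefore dominates. *)
Lemma nbin_rem_le m K w (rho : R) : `|w| <= rho%:C -> rho < 1 ->
  `|nbin_rem m K w| <= nbin_rem m K rho%:C.
Proof.
move=> wr r1.
have d0 : 0 < 1 - rho%:C by rewrite subr_gt0 ltcR.
have dn : 1 - rho%:C <= `|1 - w|.
  apply: le_trans (_ : 1 - `|w| <= _); first by rewrite lerB.
  by rewrite -[X in X - _ <= _](normr1 R[i]) lerB_dist.
have d1 : 1 - w != 0 by rewrite -normr_gt0 (lt_le_trans d0).
have i0 : 0 <= (1 - rho%:C)^-1 by rewrite invr_ge0 ltW.
have iw : `|(1 - w)^-1| <= (1 - rho%:C)^-1.
  by rewrite normfV lef_pV2 ?posrE ?normr_gt0.
case: K => [|K].
  rewrite /nbin_rem /nbin_sum !big_geq// !subr0 -!exprVn normrX.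
  by apply: lerXn2r; rewrite ?nnegrE.
elim: m => [|m IH]; first by rewrite !nbin_rem0S normr0.
rewrite !nbin_remS//; last by rewrite gt_eqF.
rewrite normrM; apply: ler_pM => //.
apply: le_trans (ler_normD _ _) _; apply: lerD => //.
rewrite normrM norm_real_complex (ger0_norm (nbin_ge0 _ _)).
apply: ler_wpM2l; first by rewrite lecR nbin_ge0.
rewrite normrX; apply: lerXn2r => //; rewrite nnegrE//.
exact: le_trans wr.
Qed.

Lemma nbin_rem_real m K (rho : R) : 0 <= rho -> rho < 1 ->
  nbin_rem m K rho%:C = ((1 - rho) `^ (- m%:R) - pseries (nbin m) rho K)%:C.
Proof.
move=> r0 r1; rewrite /nbin_rem rmorphB/=; congr (_ - _).
  by rewrite powRN powR_mulrn ?subr_ge0 ?ltW// fmorphV rmorphXn/= rmorphB.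
rewrite /nbin_sum /pseries /series/= rmorph_sum; apply: eq_bigr => k _.
by rewrite -rmorphXn -rmorphM.
Qed.

Lemma nbin_rem_bound m (rho : R) : 0 <= rho -> rho < 1 ->
  exists2 e : nat -> R, e @ \oo --> (0 : R) &
    forall K w, `|w| <= rho%:C -> `|nbin_rem m K w| <= (e K)%:C.
Proof.
move=> r0 r1; exists (fun K => (1 - rho) `^ (- m%:R) - pseries (nbin m) rho K); last first.
  by move=> K w wr; rewrite -nbin_rem_real//; exact: nbin_rem_le.
have r1' : `|rho| < 1 by rewrite ger0_norm.
have E := @binomial_series R (- m%:R) rho r1'; rewrite opprK in E.
rewrite -[X in _ --> X](subrr ((1 - rho) `^ (- m%:R))); apply: cvgB; first exact: cvg_cst.
rewrite -E; apply: psum_cvg r1'; exact: radius_rhyp.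
Qed.

End NegativeBinomial.

(** * Integrals of rational kernels with a pole on the cut *)

Section ComplexIntegral.
Context d (T : measurableType d) (R : realType).
Variable mu : {measure set T -> \bar R}.
Variables (D : set T) (w : T -> R).
Hypotheses (mD : measurable D) (iw : mu.-integrable D (EFin \o w)).
Hypothesis w0 : forall t, D t -> 0 <= w t.
Local Notation Re := (@complex.Re R).
Local Notation Im := (@complex.Im R).
Implicit Types (h : T -> R[i]) (z : R[i]).

(** Bounded measurable complex functions: a class closed under the operations that
    build the rational kernels below. *)
Definition cbmeas h := [/\ measurable_fun D (Re \o h), measurable_fun D (Im \o h) &
  exists B : R, forall t, D t -> `|h t| <= B%:C].

Definition cint h : R[i] :=
  (\int[mu]_(t in D) (w t * Re (h t))) +i* (\int[mu]_(t in D) (w t * Im (h t))).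

Lemma cbmeas_cst z : cbmeas (fun=> z).
Proof.
split; [exact: measurable_cst|exact: measurable_cst|].
by exists (Re `|z|) => t _; rewrite normc_def.
Qed.

Lemma cbmeasB h1 h2 : cbmeas h1 -> cbmeas h2 -> cbmeas (fun t => h1 t - h2 t).
Proof.
move=> [r1 i1 [B1 H1]] [r2 i2 [B2 H2]]; split.
- apply: (eq_measurable_fun _ _ (measurable_funB r1 r2)) => t _ /=; exact/esym/ReB.
- apply: (eq_measurable_fun _ _ (measurable_funB i1 i2)) => t _ /=; exact/esym/ImB.
- exists (B1 + B2) => t Dt; rewrite rmorphD/= (le_trans (ler_normB _ _))//.
  by apply: lerD; [exact: H1|exact: H2].
Qed.

Lemma cbmeasM h1 h2 : cbmeas h1 -> cbmeas h2 -> cbmeas (fun t => h1 t * h2 t).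
Proof.
move=> [r1 i1 [B1 H1]] [r2 i2 [B2 H2]]; split.
- apply: (eq_measurable_fun _ _ (measurable_funB (measurable_funM r1 r2) (measurable_funM i1 i2))).
  by move=> t _ /=; exact/esym/ReM.
- apply: (eq_measurable_fun _ _ (measurable_funD (measurable_funM r1 i2) (measurable_funM i1 r2))).
  by move=> t _ /=; exact/esym/ImM.
- exists (B1 * B2) => t Dt; rewrite rmorphM/= normrM.
  by apply: ler_pM => //; [exact: H1|exact: H2].
Qed.

Lemma cbmeasX h k : cbmeas h -> cbmeas (fun t => h t ^+ k).
Proof.
move=> Hh; elim: k => [|k IH]; first exact: cbmeas_cst.
rewrite (_ : (fun t => _) = (fun t => h t * h t ^+ k)); first exact: cbmeasM.
by apply/funext => t; rewrite exprS.
Qed.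

Lemma cbmeas_sum (f : nat -> T -> R[i]) n : (forall k, cbmeas (f k)) ->
  cbmeas (fun t => \sum_(0 <= k < n) f k t).
Proof.
move=> Hf; elim: n => [|n IH].
  rewrite (_ : (fun t => _) = fun=> 0); first exact: cbmeas_cst.
  by apply/funext => t; rewrite big_geq.
rewrite (_ : (fun t => _) = fun t => \sum_(0 <= k < n) f k t - (- 1) * f n t).
  apply: cbmeasB => //; apply: cbmeasM => //; exact: cbmeas_cst.
by apply/funext => t; rewrite big_nat_recr//= mulN1r opprK.
Qed.

Lemma cbmeas_real (s : T -> R) B : measurable_fun D s -> (forall t, D t -> `|s t| <= B) ->
  cbmeas (fun t => (s t)%:C).
Proof.
move=> ms sB; split => //; first exact: measurable_cst.
by exists B => t Dt; rewrite norm_real_complex lecR sB.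
Qed.

(** The real power of exponent -1 makes measurability of the inverse immediate. *)
Lemma complex_invE z : z^-1 = (Re z * (Re z ^+ 2 + Im z ^+ 2) `^ (-1)) +i*
  (- (Im z) * (Re z ^+ 2 + Im z ^+ 2) `^ (-1)).
Proof. by rewrite powR_inv1 ?addr_ge0 ?sqr_ge0//; case: z => a b /=; rewrite mulNr. Qed.

Lemma cbmeasV h delta : 0 < delta -> (forall t, D t -> delta%:C <= `|h t|) ->
  cbmeas h -> cbmeas (fun t => (h t)^-1).
Proof.
move=> d0 hd [r i _].
have m2 : measurable_fun D (fun t => (Re (h t) ^+ 2 + Im (h t) ^+ 2) `^ (-1)).
  apply: (measurableT_comp (measurable_powR _)).
  by apply: measurable_funD; apply: measurable_funX.
split.
- apply: (eq_measurable_fun _ _ (measurable_funM r m2)) => t _ /=.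
  by rewrite [in RHS]complex_invE.
- apply: (eq_measurable_fun _ _ (measurable_funM (measurable_funN i) m2)) => t _ /=.
  by rewrite [in RHS]complex_invE.
- exists delta^-1 => t Dt; rewrite normfV fmorphV.
  have hp : 0 < `|h t| by apply: lt_le_trans (hd t Dt); rewrite ltcR.
  by rewrite lef_pV2 ?hd// posrE ?ltcR.
Qed.

Lemma cbmeas_bound h : cbmeas h -> exists B : R, forall t, D t -> `|Re (h t)| <= B /\ `|Im (h t)| <= B.
Proof.
move=> [_ _ [B HB]]; exists B => t Dt; split; rewrite -lecR.
- exact: le_trans (normc_ge_Re _) (HB t Dt).
- exact: le_trans (normc_ge_Im _) (HB t Dt).
Qed.

Lemma cbmeas_integrable h : cbmeas h ->
  mu.-integrable D (fun t => (w t * Re (h t))%:E) /\ mu.-integrable D (fun t => (w t * Im (h t))%:E).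
Proof.
move=> Hh; have [B HB] := cbmeas_bound Hh; case: Hh => r i _; split.
- by apply: (@integrable_weight _ _ _ mu D w (Re \o h) B) => // t /HB[].
- by apply: (@integrable_weight _ _ _ mu D w (Im \o h) B) => // t /HB[].
Qed.

Lemma cintB h1 h2 : cbmeas h1 -> cbmeas h2 -> cint (fun t => h1 t - h2 t) = cint h1 - cint h2.
Proof.
move=> /cbmeas_integrable[r1 i1] /cbmeas_integrable[r2 i2]; apply: complex_eqP => /=.
- by rewrite -RintegralB//; apply: eq_Rintegral => t _; rewrite ReB mulrBr.
- by rewrite -RintegralB//; apply: eq_Rintegral => t _; rewrite ImB mulrBr.
Qed.

Lemma cintMr h z : cbmeas h -> cint (fun t => h t * z) = cint h * z.
Proof.
move=> /cbmeas_integrable[r i]; case: z => a b; apply: complex_eqP => /=.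
- rewrite -!RintegralZr// -RintegralB//; last 2 first.
  + exact: (integrableZr mD a r).
  + exact: (integrableZr mD b i).
  by apply: eq_Rintegral => t _; rewrite ReM/=; ring.
- rewrite -!RintegralZr// -RintegralD//; last 2 first.
  + exact: (integrableZr mD b r).
  + exact: (integrableZr mD a i).
  by apply: eq_Rintegral => t _; rewrite ImM/=; ring.
Qed.

Lemma cint_sum (f : nat -> T -> R[i]) n : (forall k, cbmeas (f k)) ->
  cint (fun t => \sum_(0 <= k < n) f k t) = \sum_(0 <= k < n) cint (f k).
Proof.
move=> Hf; have Hs m : cbmeas (fun t => \sum_(0 <= k < m) f k t) by exact: cbmeas_sum.
elim: n => [|n IH].
  rewrite big_geq// (_ : (fun t => _) = (fun t => 0 * 0)).
    by rewrite (cintMr 0 (cbmeas_cst 0)) mulr0.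
  by apply/funext => t; rewrite big_geq// mulr0.
rewrite big_nat_recr//= -IH (_ : (fun t => _) = (fun t => \sum_(0 <= k < n) f k t - f n t * (- 1))).
  rewrite cintB ?cintMr ?mulrN1 ?opprK//.
  by apply: cbmeasM => //; exact: cbmeas_cst.
by apply/funext => t; rewrite big_nat_recr//= mulrN1 opprK.
Qed.

Lemma cint_le h (B : R) : cbmeas h -> (forall t, D t -> `|h t| <= B%:C) ->
  `|cint h| <= (2 * B * \int[mu]_(t in D) w t)%:C.
Proof.
move=> [r i _] HB; apply: le_trans (normc_le_Re_Im _) _; rewrite lecR/=.
rewrite (_ : 2 * B * _ = B * \int[mu]_(t in D) w t + B * \int[mu]_(t in D) w t); last by ring.
apply: lerD.
- apply: (@Rintegral_weight_le _ _ _ mu D w (Re \o h)) => // t Dt.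
  by rewrite -lecR; exact: le_trans (normc_ge_Re _) (HB t Dt).
- apply: (@Rintegral_weight_le _ _ _ mu D w (Im \o h)) => // t Dt.
  by rewrite -lecR; exact: le_trans (normc_ge_Im _) (HB t Dt).
Qed.

Variables (s : T -> R) (m : nat).
Hypotheses (ms : measurable_fun D s) (s01 : forall t, D t -> 0 <= s t <= 1).

(** The generalized Stieltjes transform of the law of s under the weight w. *)
Definition stieltjes z := cint (fun t => (1 - z * (s t)%:C) ^- m).

Definition stieltjes_coef z0 k :=
  cint (fun t => (nbin R m k * s t ^+ k)%:C * (1 - z0 * (s t)%:C) ^- (m + k)).

(** Write 1 - z s = (1 - z0 s)(1 - q) with q = (z - z0) s/(1 - z0 s).  On D one has
    |q| <= rho < 1, so the binomial series in q converges uniformly and may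
    be integrated term by term. *)
Lemma stieltjes_csums z0 z (delta rho : R) : 0 < delta -> 0 <= rho -> rho < 1 ->
  (forall t, D t -> delta%:C <= `|1 - z0 * (s t)%:C|) ->
  `|z - z0| <= (rho * delta)%:C ->
  csums (stieltjes_coef z0) (z - z0) (stieltjes z).
Proof.
move=> d0 r0 r1 Hd zr.
have cs : cbmeas (fun t => (s t)%:C).
  by apply: (cbmeas_real (B := 1)) => // t /s01/andP[h1 h2]; rewrite ger0_norm.
have cl y : cbmeas (fun t => 1 - y * (s t)%:C).
  by apply: cbmeasB; [exact: cbmeas_cst|apply: cbmeasM => //; exact: cbmeas_cst].
have d0C : 0 < delta%:C by rewrite ltcR.
have n0 t : D t -> 1 - z0 * (s t)%:C != 0.
  by move=> Dt; rewrite -normr_gt0 (lt_le_trans d0C)// Hd.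
pose q t := (z - z0) * (s t)%:C / (1 - z0 * (s t)%:C).
have qr t : D t -> `|q t| <= rho%:C.
  move=> Dt; rewrite /q normf_div ler_pdivrMr ?normr_gt0 ?n0// normrM.
  have /andP[s0 s1] := s01 Dt.
  apply: le_trans (_ : (rho * delta)%:C * 1 <= _).
    apply: ler_pM => //; rewrite norm_real_complex ger0_norm//.
    by rewrite (_ : 1 = 1%:C) ?lecR.
  by rewrite mulr1 rmorphM/=; apply: ler_wpM2l; [rewrite lecR|exact: Hd].
have fac t : D t -> 1 - z * (s t)%:C = (1 - z0 * (s t)%:C) * (1 - q t).
  by move=> /n0 h; rewrite /q; field.
have r1C : 0 < 1 - rho%:C by rewrite subr_gt0 ltcR.
have q1 t : D t -> (1 - rho)%:C <= `|1 - q t|.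
  move=> Dt; rewrite rmorphB/=; apply: le_trans (_ : 1 - `|q t| <= _); first by rewrite lerB ?qr.
  by rewrite -[X in X - _ <= _](normr1 R[i]) lerB_dist.
have q1n t : D t -> 1 - q t != 0.
  by move=> Dt; rewrite -normr_gt0; apply: lt_le_trans (q1 t Dt); rewrite ltcR subr_gt0.
have ck k : cbmeas (fun t => (nbin R m k * s t ^+ k)%:C * (1 - z0 * (s t)%:C) ^- (m + k)).
  apply: cbmeasM.
    rewrite (_ : (fun t => _) = (fun t => (nbin R m k)%:C * (s t)%:C ^+ k)).
      by apply: cbmeasM; [exact: cbmeas_cst|exact: cbmeasX].
    by apply/funext => t; rewrite rmorphM rmorphXn.
  rewrite (_ : (fun t => _) = (fun t => ((1 - z0 * (s t)%:C)^-1) ^+ (m + k))).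
    by apply: cbmeasX; exact: (cbmeasV d0 Hd).
  by apply/funext => t; rewrite exprVn.
have cz : cbmeas (fun t => (1 - z * (s t)%:C) ^- m).
  rewrite (_ : (fun t => _) = (fun t => ((1 - z * (s t)%:C)^-1) ^+ m)).
    apply: cbmeasX; apply: (@cbmeasV _ (delta * (1 - rho))) => //.
      by rewrite mulr_gt0// subr_gt0.
    move=> t Dt; rewrite fac// normrM rmorphM/=.
    apply: ler_pM; [exact: ltW| |exact: Hd|exact: q1].
    by rewrite (_ : 0 = 0%:C)// lecR subr_ge0 ltW.
  by apply/funext => t; rewrite exprVn.
have [e e0 He] := @nbin_rem_bound R m rho r0 r1.
pose I := \int[mu]_(t in D) w t.
apply: (@cvg_dist_leC _ _ _ (fun K => 2 * (delta ^- m * e K) * I)); last first.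
  rewrite [X in _ --> X](_ : _ = 2 * (delta ^- m * 0) * I); last by ring.
  by apply: cvgM; [apply: cvgM; [exact: cvg_cst|apply: cvgM => //; exact: cvg_cst]|exact: cvg_cst].
move=> K; rewrite /series/=.
pose f k t := (nbin R m k * s t ^+ k)%:C * (1 - z0 * (s t)%:C) ^- (m + k) * (z - z0) ^+ k.
have cf k : cbmeas (f k) by apply: cbmeasM => //; exact: cbmeas_cst.
have -> : \sum_(0 <= k < K) stieltjes_coef z0 k * (z - z0) ^+ k = cint (fun t => \sum_(0 <= k < K) f k t).
  by rewrite cint_sum//; apply: eq_bigr => k _; rewrite /f cintMr.
rewrite -cintB//; last exact: cbmeas_sum.
apply: cint_le; first by apply: cbmeasB => //; exact: cbmeas_sum.
move=> t Dt.
have -> : (1 - z * (s t)%:C) ^- m - \sum_(0 <= k < K) f k t =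
    (1 - z0 * (s t)%:C) ^- m * nbin_rem m K (q t).
  rewrite /nbin_rem mulrBr fac// exprMn invfM; congr (_ - _).
  rewrite /nbin_sum mulr_sumr; apply: eq_bigr => k _.
  rewrite /f /q exprD invfM rmorphM rmorphXn/= exprMn exprVn exprMn; ring.
rewrite normrM rmorphM/=; apply: ler_pM => //; last by apply: He; exact: qr.
rewrite -exprVn normrX normfV fmorphV rmorphXn/= -exprVn.
apply: lerXn2r; rewrite ?nnegrE ?invr_ge0//; first exact: ltW.
by rewrite lef_pV2 ?posrE ?normr_gt0 ?n0// Hd.
Qed.

Lemma stieltjes_coef0 k :
  stieltjes_coef 0 k = (nbin R m k * \int[mu]_(t in D) (w t * s t ^+ k))%:C.
Proof.
have iwk : mu.-integrable D (fun t => (w t * s t ^+ k)%:E).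
  apply: (@integrable_weight _ _ _ mu D w _ 1) => //; first exact: measurable_funX.
  by move=> t /s01/andP[h1 h2]; rewrite ger0_norm ?exprn_ge0// exprn_ile1.
rewrite -RintegralZl//; apply: complex_eqP => /=.
- by apply: eq_Rintegral => t _; rewrite mul0r subr0 expr1n invr1 mulr1/=; ring.
- transitivity (\int[mu]_(t in D) (0 : R)); last by rewrite Rintegral_cst// mul0r.
  by apply: eq_Rintegral => t _; rewrite mul0r subr0 expr1n invr1 mulr1/= mulr0.
Qed.

End ComplexIntegral.

(** Off the cut the poles 1/s stay away from z.  If z is not real, this follows
    from the imaginary part of (1 - z s) times the conjugate of z, which is
    minus that of z whatever s is; if z < 1 is real, the function is affine in s. *)
Lemma slit_distance (R : realType) (z : R[i]) : slit_plane z ->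
  exists2 delta : R, 0 < delta & forall s : R, 0 <= s <= 1 -> delta%:C <= `|1 - z * s%:C|.
Proof.
case: z => a b hz; have [b0|b0] := eqVneq b 0.
  have a1 : a < 1.
    by rewrite ltNge; apply/negP => a1; apply: hz; exists a; rewrite // b0.
  exists (Num.min 1 (1 - a)); first by rewrite lt_min ltr01 subr_gt0.
  move=> s /andP[s0 s1]; apply: le_trans (normc_ge_Re _); rewrite lecR/= b0 mul0r subr0.
  apply: le_trans (ler_norm _); have [a0|a0] := leP a 0.
    by rewrite ge_min; apply/orP; left; have := mulr_le0_ge0 a0 s0; lra.
  by rewrite ge_min; apply/orP; right; have := ler_piMr (ltW a0) s1; lra.
set z : R[i] := a +i* b.
have z0 : z != 0 by rewrite eq_complex/= negb_and b0 orbT.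
have nz0 : 0 < `|z| by rewrite normr_gt0.
have [r nzE] : exists r : R, `|z| = r%:C by exists (complex.Re `|z|); exact: pos_complex_real.
have r0 : 0 < r by move: nz0; rewrite nzE ltcR.
exists (`|b| / r); first by rewrite divr_gt0 ?normr_gt0.
move=> s _; rewrite rmorphM fmorphV /= -nzE ler_pdivrMr//.
rewrite -(normcJ z) -normrM; apply: le_trans (normc_ge_Im _).
by rewrite lecR -normrN le_eqVlt; apply/orP; left; rewrite /z/=; apply/eqP; congr (`|_|); ring.
Qed.

(** * Existence of the analytic continuation *)

Section BaseCase.
Variable R : realType.
Local Notation mu := (@lebesgue_measure R).
Local Notation T2 := (measurableTypeR R * measurableTypeR R)%type.
Implicit Types (p q a b c : R).

Lemma ge0_integral_prod (f g : R -> R) (D1 D2 : set R) : measurable D1 -> measurable D2 ->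
  measurable_fun D1 f -> measurable_fun D2 g ->
  (forall x, D1 x -> 0 <= f x) -> (forall x, D2 x -> 0 <= g x) ->
  (\int[(mu \x mu)%E]_(z in D1 `*` D2) (f z.1 * g z.2)%:E =
   (\int[mu]_(x in D1) (f x)%:E) * (\int[mu]_(y in D2) (g y)%:E))%E.
Proof.
move=> mD1 mD2 mf mg f0 g0.
have mf' : measurable_fun setT (f \_ D1) by apply/(measurable_restrictT f mD1).
have mg' : measurable_fun setT (g \_ D2) by apply/(measurable_restrictT g mD2).
have f0' x : 0 <= (f \_ D1) x by rewrite patchE; case: ifPn => // /[!inE] /f0.
have g0' x : 0 <= (g \_ D2) x by rewrite patchE; case: ifPn => // /[!inE] /g0.
pose h := fun z : R * R => ((f \_ D1) z.1 * (g \_ D2) z.2)%:E.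
have mh : measurable_fun setT h.
  apply/measurable_EFinP; apply: measurable_funM; first exact: measurableT_comp.
  exact: measurableT_comp.
rewrite integral_mkcond.
transitivity (\int[(mu \x mu)%E]_z h z)%E.
  apply: eq_integral => -[x y] _; rewrite /h patchE in_setX/= !patchE.
  by case: (x \in D1); case: (y \in D2); rewrite /= ?mul0r ?mulr0.
rewrite fubini_tonelli1//; last by move=> z; rewrite lee_fin mulr_ge0.
transitivity (\int[mu]_x (((f \_ D1) x)%:E * \int[mu]_y ((g \_ D2) y)%:E))%E.
  apply: eq_integral => x _; rewrite /fubini_F/h/= -ge0_integralZl ?lee_fin//.
  - exact/measurable_EFinP.
  - by move=> y _; rewrite lee_fin.
rewrite ge0_integralZr//; last 3 first.
- exact/measurable_EFinP.
- by move=> y _; rewrite lee_fin.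
- by apply: integral_ge0 => y _; rewrite lee_fin.
congr (_ * _)%E; rewrite [RHS]integral_mkcond; apply: eq_integral => x _;
  by rewrite !patchE; case: ifP.
Qed.

Definition beta_weight p q x : R := (x - 0) `^ (p - 1) * (1 - x) `^ (q - 1).
Definition beta_value p q : R := Gamma p * Gamma q / Gamma (p + q).

Lemma beta_value_gt0 p q : 0 < p -> 0 < q -> 0 < beta_value p q.
Proof.
by move=> p0 q0; rewrite divr_gt0 ?mulr_gt0 ?Gamma_gt0// addr_gt0.
Qed.

Lemma beta_value_ratio p q k : 0 < p -> 0 < q ->
  beta_value (p + k%:R) q = beta_value p q * (rpoch p k / rpoch (p + q) k).
Proof.
move=> p0 q0; have pq0 := addr_gt0 p0 q0.
rewrite /beta_value addrAC !Gamma_rpoch//; field.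
by rewrite !gt_eqF ?rpoch_gt0 ?Gamma_gt0.
Qed.

Lemma integral_beta_weight2 p q p' q' : 0 < p -> 0 < q -> 0 < p' -> 0 < q' ->
  (\int[(mu \x mu)%E]_(z in `]0%R, 1%R[ `*` `]0%R, 1%R[)
     (beta_weight p q z.1 * beta_weight p' q' z.2)%:E)%E =
  (beta_value p q * beta_value p' q')%:E.
Proof.
move=> p0 q0 p0' q0'.
rewrite ge0_integral_prod//; try exact: measurable_beta.
- by rewrite !eintegral_beta// subr0 !powR1 !mul1r -EFinM.
- by move=> x _; rewrite mulr_ge0// powR_ge0.
- by move=> x _; rewrite mulr_ge0// powR_ge0.
Qed.

Lemma beta_weightX p q k x : 0 < x -> beta_weight p q x * x ^+ k = beta_weight (p + k%:R) q x.
Proof.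
move=> x0; rewrite /beta_weight subr0 mulrAC -powR_mulrn ?ltW// -powRD_gt0//.
by congr (_ `^ _ * _); ring.
Qed.

(** The law of the product of two independent beta variables, with parameters
    (a, c-a) and (b, m-b), has the moments (a)_k (b)_k / ((c)_k (m)_k); the
    kernel supplies the missing factor (m)_k/k!. *)
Lemma has_hyp2F1_base a b c : 0 < a -> a < c -> 0 < b -> has_hyp2F1 a b c.
Proof.
move=> a0 ac b0.
have ca0 : 0 < c - a by rewrite subr_gt0.
(* any integer above b would do *)
pose m := (Num.truncn b).+1.
have mb0 : 0 < m%:R - b by rewrite subr_gt0 truncnS_gt// ltW.
pose D : set T2 := `]0%R, 1%R[ `*` `]0%R, 1%R[.
have mD : measurable D by exact: measurableX.
pose w (z : T2) := beta_weight a (c - a) z.1 * beta_weight b (m%:R - b) z.2.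
pose s (z : T2) := z.1 * z.2.
have w0 z : D z -> 0 <= w z by move=> _; rewrite !mulr_ge0// powR_ge0.
have mw : measurable_fun [set: T2] w.
  by apply: measurable_funM; apply: measurableT_comp => //; exact: measurable_beta.
have ms : measurable_fun D s by apply: measurable_funTS; exact: measurable_funM.
have s01 z : D z -> 0 <= s z <= 1.
  move=> [] /=; rewrite !in_itv/= => /andP[x0 x1] /andP[y0 y1].
  by rewrite /s; apply/andP; split; [rewrite mulr_ge0 ?ltW|rewrite mulr_ile1 ?ltW].
have iw : (mu \x mu)%E.-integrable D (EFin \o w).
  apply/integrableP; split; first by apply/measurable_EFinP; exact: measurable_funTS.
  suff -> : (\int[(mu \x mu)%E]_(z in D) `|(EFin \o w) z|)%E =
      (beta_value a (c - a) * beta_value b (m%:R - b))%:E by rewrite ltry.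
  rewrite -integral_beta_weight2//; apply: eq_integral => z /[!inE] Dz.
  by rewrite /= ger0_norm// w0.
have moment k : \int[(mu \x mu)%E]_(z in D) (w z * s z ^+ k) =
    beta_value (a + k%:R) (c - a) * beta_value (b + k%:R) (m%:R - b).
  rewrite /Rintegral; suff -> : (\int[(mu \x mu)%E]_(z in D) (w z * s z ^+ k)%:E)%E =
    (beta_value (a + k%:R) (c - a) * beta_value (b + k%:R) (m%:R - b))%:E by [].
  rewrite -integral_beta_weight2//; try by rewrite ltr_wpDr.
  apply: eq_integral => z /[!inE] -[] /=; rewrite !in_itv/= => /andP[x0 x1] /andP[y0 y1].
  by rewrite -!beta_weightX// /w /s exprMn; congr EFin; ring.
pose N := beta_value a (c - a) * beta_value b (m%:R - b).
have N0 : 0 < N by rewrite mulr_gt0// beta_value_gt0.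
exists (fun z => (N^-1)%:C * stieltjes (mu \x mu)%E D w s m z).
have scale z0 z : csums (stieltjes_coef (mu \x mu)%E D w s m z0) (z - z0) (stieltjes (mu \x mu)%E D w s m z) ->
  csums (fun k => (N^-1)%:C * stieltjes_coef (mu \x mu)%E D w s m z0 k) (z - z0)
    ((N^-1)%:C * stieltjes (mu \x mu)%E D w s m z).
  move=> H; have Z : csums (fun=> 0 : R[i]) (z - z0) 0.
    rewrite /csums (_ : series _ = fun=> 0); first exact: cvg_cst.
    by apply/funext => n; rewrite /series/= big1// => i _; rewrite mul0r.
  by have := @csums_lin R _ _ _ _ _ (N^-1)%:C Z H; rewrite add0r; congr (csums _ _ _);
    apply/funext => k; rewrite add0r.
split.
- move=> z z1.
  have := @scale 0 z; rewrite subr0.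
  rewrite (_ : (fun k => _) = hyp2F1_coef a%:C b%:C c%:C).
    apply; rewrite -[X in csums _ X _]subr0.
    have [r nz] : exists r : R, `|z| = r%:C.
      by exists (complex.Re `|z|); apply/esym; exact: (@RRe_real R `|z| (normr_real z)).
    apply: (@stieltjes_csums _ _ _ _ _ _ mD iw w0 _ _ ms s01 0 z 1 r) => //.
    - by rewrite -lecR -nz normr_ge0.
    - by rewrite -ltcR -nz.
    - by move=> t _; rewrite mul0r subr0 normr1.
    - by rewrite subr0 mulr1 -nz.
  apply/funext => k; rewrite hyp2F1_coef_real stieltjes_coef0// moment -rmorphM/=; congr (_%:C).
  rewrite !beta_value_ratio// nbinE /rhyp /N.
  have -> : a + (c - a) = c by ring.
  have -> : b + (m%:R - b) = m%:R by ring.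
  field.
  by rewrite !gt_eqF ?rpoch_gt0 ?beta_value_gt0 ?ltr0n ?fact_gt0// (lt_trans a0).
- move=> z0 /slit_distance[delta d0 Hd].
  exists (fun k => (N^-1)%:C * stieltjes_coef (mu \x mu)%E D w s m z0 k), delta; split => // z zd.
  apply: scale.
  have [r nz] : exists r : R, `|z - z0| = r%:C.
    by exists (complex.Re `|z - z0|); apply/esym; exact: (@RRe_real R `|z - z0| (normr_real _)).
  apply: (@stieltjes_csums _ _ _ _ _ _ mD iw w0 _ _ ms s01 z0 z delta (r / delta)) => //.
  - by rewrite divr_ge0 ?(ltW d0)// -lecR -nz normr_ge0.
  - by rewrite ltr_pdivrMr// mul1r -ltcR -nz.
  - by move=> t /s01; exact: Hd.
  - by rewrite divfK ?gt_eqF// -nz.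
Qed.

End BaseCase.

(** In the contiguous relation that raises b, the parameters a and c stay as they are
    or are raised together, so 0 < a < c is kept. *)
Lemma has_hyp2F1_raise_b (R : realType) (n : nat) (a b c : R) :
  0 < a -> a < c -> 0 < b + n%:R -> has_hyp2F1 a b c.
Proof.
elim: n a b c => [|n IH] a b c a0 ac bn.
  by apply: has_hyp2F1_base => //; rewrite addr0 in bn.
apply: has_hyp2F1_sym; apply: has_hyp2F1_contiguous; first by lra.
  by apply: has_hyp2F1_sym; apply: IH => //; move: bn; rewrite -natr1; lra.
by apply: has_hyp2F1_sym; apply: IH; [lra|lra|move: bn; rewrite -natr1; lra].
Qed.

(** The values of a met on the way up do not exceed 1, hence stay below c. *)
Lemma has_hyp2F1_raise_a (R : realType) (n : nat) (a b c : R) :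
  0 < a + n%:R -> a + n%:R <= 1 -> 1 < c -> has_hyp2F1 a b c.
Proof.
elim: n a b c => [|n IH] a b c an an1 c1.
  rewrite addr0 in an an1.
  have [k bk] : exists k : nat, 0 < b + k%:R.
    exists (Num.truncn `|b|).+1; have := @truncnS_gt R `|b|.
    by have := ler_norm (- b); rewrite normrN; lra.
  by apply: (@has_hyp2F1_raise_b R k) => //; lra.
move: an an1; rewrite -natr1 => an an1.
by apply: has_hyp2F1_contiguous; [lra|apply: IH; lra|apply: IH; lra].
Qed.

Lemma is_hyp2F1_exists (R : realType) (a b c : R) : a <= 1 -> 1 < c ->
  exists F, is_hyp2F1 a%:C b%:C c%:C F.
Proof.
move=> a1 c1; apply: (@has_hyp2F1_raise_a R (Num.truncn (1 - a))) => //.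
  by have := @truncnS_gt R (1 - a); rewrite -natr1; lra.
by have := @truncn_le R (1 - a); rewrite subr_ge0 a1; lra.
Qed.

(** * Values on the negative axis and the C-Jacobi function *)

Section NegativeAxis.
Variable R : realType.
Implicit Types (t A B c k : R).

Lemma near_derive1_eq (f g g' : R -> R) t : (\forall s \near t, f s = g s) ->
  is_derive t 1 g (g' t) -> derive1 f t = g' t.
Proof.
move=> fg D; rewrite derive1E (@near_eq_derive _ _ _ _ g)//.
exact: (@derive_val _ _ _ _ _ _ _ D).
Qed.

Lemma near_unit t : `|t| < 1 -> \forall s \near t, `|s : R| < 1.
Proof.
move=> t1; apply/nbhs_ballP; exists (1 - `|t|) => /=; first by rewrite subr_gt0.
move=> s /=; rewrite /ball_/= => h.
have := ler_distD t s 0; rewrite !subr0 (distrC s t) => h'.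
by apply: (le_lt_trans h'); rewrite -ltrBrDr.
Qed.

(** The equation holds for t < 1, where phi is a multiple of the series; its left-hand
    side is real analytic, hence it vanishes on the whole half line, and
    [pfaff_unique] applies. *)
Lemma ranalytic_pfaff A B c k (phi : R -> R) : 0 < c ->
  (forall t, 0 <= t -> ranalytic_at phi t) ->
  (forall t, `|t| < 1 -> phi t = k * psum (rhyp (c - B) A c) (- t)) ->
  forall t, 0 <= t -> phi t = k * ((1 + t) `^ (- A) * psum (rhyp A B c) (t / (1 + t))).
Proof.
move=> c0 anphi phiE.
set h := rhyp (c - B) A c in phiE.
have Hh : radius_ge 1 h by exact: radius_rhyp.
have Hh1 := radius_ge_diffs Hh; have Hh2 := radius_ge_diffs Hh1.
pose phi1 := derive1 phi; pose phi2 := derive1 phi1.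
have an1 t : 0 <= t -> ranalytic_at phi1 t by move=> /anphi/ranalytic_derive1[].
have an2 t : 0 <= t -> ranalytic_at phi2 t by move=> /an1/ranalytic_derive1[].
have dN (g : nat -> R) t : radius_ge 1 g -> `|t| < 1 ->
    is_derive t 1 (fun t => psum g (- t)) (- psum (pseries_diffs g) (- t)).
  move=> Hg t1; have tN : `|- t| < 1 by rewrite normrN.
  have dn : is_derive t 1 (fun t : R => - t) (- 1) by exact: is_deriveNid.
  have := @is_derive_comp _ (psum g) (fun t : R => - t) t _ _ (is_derive_psum Hg tN) dn.
  by rewrite mulrN1.
have phi1E t : `|t| < 1 -> phi1 t = - k * psum (pseries_diffs h) (- t).
  move=> t1; apply: (@near_derive1_eq _ (fun t => k * psum h (- t))
    (fun t => - k * psum (pseries_diffs h) (- t))).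
    by apply: filterS (near_unit t1) => s; exact: phiE.
  by have := is_derive_scale k (dN h t Hh t1); rewrite mulNr mulrN.
have phi2E t : `|t| < 1 -> phi2 t = k * psum (pseries_diffs (pseries_diffs h)) (- t).
  move=> t1; apply: (@near_derive1_eq _ (fun t => - k * psum (pseries_diffs h) (- t))
    (fun t => k * psum (pseries_diffs (pseries_diffs h)) (- t))).
    by apply: filterS (near_unit t1) => s; exact: phi1E.
  by have := is_derive_scale (- k) (dN _ t Hh1 t1); rewrite mulrNN.
have ode t : 0 <= t -> t * (1 + t) * phi2 t + (c + (c - B + A + 1) * t) * phi1 t
     + (c - B) * A * phi t = 0.
  pose L t := 1 * (1 * (t * phi2 t) + 1 * (t * (t * phi2 t))) +
    1 * (1 * (c * phi1 t + (c - B + A + 1) * (t * phi1 t)) + (c - B) * A * phi t).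
  have -> : t * (1 + t) * phi2 t + (c + (c - B + A + 1) * t) * phi1 t
     + (c - B) * A * phi t = L t by rewrite /L; ring.
  move: t; apply: (@ranalytic_identity _ L 1) => //.
    move=> t t0; have a0 := anphi t t0; have a1 := an1 t t0; have a2 := an2 t t0.
    apply: ranalytic_lin.
      by apply: ranalytic_lin; do ?apply: ranalytic_mulX.
    apply: ranalytic_lin => //.
    by apply: ranalytic_lin => //; exact: ranalytic_mulX.
  move=> t /andP[t0 t1]; have ht : `|t| < 1 by rewrite ger0_norm.
  have htN : `|- t| < 1 by rewrite normrN.
  have := hypergeometric_ode (c - B) A c0 htN; rewrite -/h.
  rewrite /L phiE// phi1E// phi2E// => H.
  rewrite -[RHS](mulr0 (- k)) -[in RHS]H; ring.
have d1 t : 0 <= t -> is_derive t 1 phi (phi1 t) by move=> /anphi/ranalytic_derive1[].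
have d2 t : 0 <= t -> is_derive t 1 phi1 (phi2 t) by move=> /an1/ranalytic_derive1[].
move=> t t0; rewrite (pfaff_unique (A := A) (B := B) c0 d1 d2 ode t0).
by rewrite phiE ?normr0// oppr0 psum0 /h rhyp0 mulr1.
Qed.

(** The real part is the case k = 1 of [ranalytic_pfaff] and the imaginary part the
    case k = 0. *)
Lemma hyp2F1_negative_axis A B c F t : 0 < c -> is_hyp2F1 (c - B)%:C A%:C c%:C F -> 0 <= t ->
  F (- t)%:C = ((1 + t) `^ (- A) * psum (rhyp A B c) (t / (1 + t)))%:C.
Proof.
move=> c0 HF t0; have [_ an] := HF.
have F1 s : `|s| < 1 -> F (- s)%:C = (psum (rhyp (c - B) A c) (- s))%:C.
  by move=> s1; apply: (hyp2F1_disc c0 HF); rewrite normrN.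
have anF s : 0 <= s -> canalytic_at F (- s)%:C by move=> /slit_plane_nonpos; exact: an.
apply: complex_eqP => /=.
- rewrite (@ranalytic_pfaff A B c 1 (fun t => complex.Re (F (- t)%:C)))// ?mul1r//.
    by move=> s /anF/canalytic_ranalytic[].
  by move=> s /F1 ->; rewrite mul1r.
- rewrite (@ranalytic_pfaff A B c 0 (fun t => complex.Im (F (- t)%:C)))// ?mul0r//.
    by move=> s /anF/canalytic_ranalytic[].
  by move=> s /F1 ->; rewrite mul0r.
Qed.

End NegativeAxis.

Lemma hyp2F1P (R : realType) (a b c : R) : a <= 1 -> 1 < c ->
  is_hyp2F1 a%:C b%:C c%:C (hyp2F1 a%:C b%:C c%:C).
Proof. by move=> a1 c1; have := xgetPex (fun=> 0) (is_hyp2F1_exists b a1 c1). Qed.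

Theorem theorem3p6 (R : realType) (n : nat) (nu al be x : R) :
  (0 < n)%N -> n%:R - 1 < nu -> nu < n%:R -> -1 < al -> 0 < be ->
  -1 < x -> x < 1 ->
  C_jacobi n nu al be x =
    m1pow nu * (Gamma (nu + be + 1) / (Gamma (nu + 1) * Gamma (be + 1)))%:C *
    (((1 - x) / 2) `^ nu)%:C *
    hyp2F1 (- nu)%:C (- nu - al)%:C (be + 1)%:C ((x + 1) / (x - 1))%:C
  /\
  C_jacobi n nu al be x =
    m1pow nu * (Gamma (nu + be + 1) / (Gamma (nu + 1) * Gamma (be + 1)))%:C *
    hyp2F1 (- nu)%:C (nu + al + be + 1)%:C (be + 1)%:C ((x + 1) / 2)%:C.
Proof.
move=> n0 nu1 nun al1 be0 x1 x1'.
have n1 : 1 <= n%:R :> R by rewrite ler1n.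
have nu0 : - nu <= 1 by lra.
have c1 : 1 < be + 1 by lra.
have c0 : 0 < be + 1 by lra.
have G1 : Gamma (nu + 1) != 0 by rewrite gt_eqF// Gamma_gt0//; lra.
have G2 : Gamma (be + 1) != 0 by rewrite gt_eqF// Gamma_gt0.
set c := be + 1; set A := - nu - al; set B := nu + be + 1.
pose u := psum (rhyp A B c) ((1 + x) / 2).
have y0 : 0 < 1 - x by lra.
have y1 : 0 < 1 + x by lra.
have p2 r : (2 : R) `^ r != 0 by rewrite gt_eqF// powR_gt0.
have py r : (1 - x) `^ r != 0 by rewrite gt_eqF// powR_gt0.
have CE : C_jacobi n nu al be x =
    m1pow nu * (Gamma B / (Gamma (nu + 1) * Gamma c))%:C * (2 `^ al / (1 - x) `^ al * u)%:C.
  rewrite /C_jacobi caputo_weight_eval//.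
  have -> : - (nu + al) = A by rewrite /A; ring.
  rewrite -/B -/c -/u -!mulrA; congr (_ * _).
  rewrite -!fmorphV -!rmorphM/=; congr (_%:C).
  rewrite powRD_gt0//; field.
  by rewrite G1 G2 !p2 !py gt_eqF// powR_gt0.
split.
- rewrite CE -[RHS]mulrA; congr (_ * _).
  pose t := (1 + x) / (1 - x).
  have t0 : 0 <= t by rewrite divr_ge0// ltW.
  have -> : (x + 1) / (x - 1) = - t by rewrite /t -mulrN -invrN opprB [x + 1]addrC.
  have -> : - nu = c - B by rewrite /c /B; ring.
  rewrite (hyp2F1_negative_axis c0 (hyp2F1P _ _ c1) t0); last by rewrite /c /B; lra.
  have -> : t / (1 + t) = (1 + x) / 2.
    by rewrite /t; field; rewrite ?gt_eqF//; lra.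
  rewrite -/u -rmorphM/=; congr (_%:C); rewrite mulrA; congr (_ * _).
  have -> : 1 + t = 2 / (1 - x) by rewrite /t; field; rewrite gt_eqF.
  have -> : - A = nu + al by rewrite /A; ring.
  have q0 : 0 < 2 / (1 - x) by rewrite divr_gt0.
  have q1 : 0 < (1 - x) / 2 by rewrite divr_gt0.
  rewrite powRD_gt0// mulrA -powRM ?(ltW q0) ?(ltW q1)//.
  have -> : (1 - x) / 2 * (2 / (1 - x)) = 1 by field; rewrite gt_eqF.
  rewrite powR1 mul1r; apply: (canLR (mulfK (py al))).
  by rewrite -powRM ?(ltW q0) ?(ltW y0)// divfK// gt_eqF.
- rewrite CE; congr (_ * _).
  have z1 : `|(x + 1) / 2| < 1 by rewrite ltr_norml; apply/andP; split; lra.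
  rewrite (hyp2F1_disc c0 (hyp2F1P _ nu0 c1) z1); congr (_%:C).
  have -> : - nu = c - B by rewrite /c /B; ring.
  have -> : nu + al + be + 1 = c - A by rewrite /c /A; ring.
  rewrite rhyp_sym -euler_transformation//; try lra.
  have -> : A + B - c = - al by rewrite /A /B /c; ring.
  have -> : 1 - (x + 1) / 2 = (1 - x) / 2 by field.
  rewrite [x + 1]addrC powRN -/u; congr (_ * _).
  apply/esym/(canLR (@invrK _)); rewrite invf_div; apply: (canRL (mulfK (p2 al))).
  by rewrite -powRM ?divfK// divr_ge0// ltW.
Qed.
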